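(* Let $1\in P\subset A$ be an inclusion of unital $C^*$-algebras and let $E\colon A\to P$ be a faithful conditional expectation with finite Watatani index. Suppose that $A$ has the LP property and that $E$ has the Rokhlin property. Then $P$ has the LP property.
   Context: LP property: a $C^*$-algebra has the LP property if the linear span of its projections is norm dense in it. Watatani index: a quasi-basis for $E$ is a finite set $\{(u_i,v_i)\}_{i=1}^n\subset A\times A$ such that $a=\sum_iu_iE(v_ia)=\sum_iE(au_i)v_i$ for all $a\in A$. $E$ has finite (Watatani) index if a quasi-basis exists, and then $\mathrm{Index}\,E=\sum_iu_iv_i$; this is independent of the quasi-basis and is a positive invertible central element of $A$. Sequence algebras: $A^\infty=\ell^\infty(\mathbb N,A)/c_0(A)$, where $c_0(A)=\{(a_n)\in\ell^\infty(\mathbb N,A):\lim_n\|a_n\|=0\}$; $A$ is identified with the classes of constant sequences, and $A_\infty=A^\infty\cap A'$. $E^\infty\colon A^\infty\to P^\infty$ is the conditional expectation induced by $E$ (applied termwise). Rokhlin property of $E$: a conditional expectation $E\colon A\to P$ with finite index has the Rokhlin property if there is a projection $e\in A_\infty$ with $E^\infty(e)=(\mathrm{Index}\,E)^{-1}\cdot1$ and such that the map $A\ni x\mapsto xe$ is injective. *)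

(* Defs.v *)
From HB Require Import structures.
From mathcomp Require Import all_boot all_order all_algebra.
From mathcomp Require Import ring_quotient generic_quotient.
From mathcomp Require Import complex.
From mathcomp Require Import mathcomp_extra boolp classical_sets functions.
From mathcomp Require Import reals topology normedtype sequences.

Set Implicit Arguments.
Unset Strict Implicit.
Unset Printing Implicit Defensive.

Import Order.TTheory GRing.Theory Num.Theory.
Import numFieldTopology.Exports numFieldNormedType.Exports.
Local Open Scope classical_set_scope.
Local Open Scope ring_scope.
Local Open Scope quotient_scope.

(* The zero algebra is allowed (pzRingType). *)
HB.mixin Record isStarRing A & GRing.PzRing A := {
  star : A -> A;
  starK : involutive star;
  starD : {morph star : x y / x + y};
  starM : forall x y, star (x * y) = star y * star x
}.

#[short(type="starRingType")]
HB.structure Definition StarRing := {A of GRing.PzRing A & isStarRing A}.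

(* Unital C*-algebras.  The norm of a [normedModType R[i]] takes its values in
   R[i] (in fact in the nonnegative reals).  Product, unit and involution are raw
   fields because HB admits no structure inheriting both from normed modules and
   from rings other than [Num.NumDomain]; the *-ring structure is attached
   to every [cstarAlgType] just below, and only [*%R], [1] and [star] are used
   afterwards. *)
HB.mixin Record isCStarAlgebra (R : realType) A & NormedModule R[i] A := {
  cs_mul : A -> A -> A;
  cs_one : A;
  cs_star : A -> A;
  cs_mulA : associative cs_mul;
  cs_mul1l : left_id cs_one cs_mul;
  cs_mul1r : right_id cs_one cs_mul;
  cs_mulDl : left_distributive cs_mul +%R;
  cs_mulDr : right_distributive cs_mul +%R;
  cs_scalerAl : forall (c : R[i]) x y, c *: cs_mul x y = cs_mul (c *: x) y;
  cs_scalerAr : forall (c : R[i]) x y, c *: cs_mul x y = cs_mul x (c *: y);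
  cs_starK : involutive cs_star;
  cs_starD : {morph cs_star : x y / x + y};
  cs_starM : forall x y, cs_star (cs_mul x y) = cs_mul (cs_star y) (cs_star x);
  cs_starZ : forall (c : R[i]) x, cs_star (c *: x) = c^* *: cs_star x;
  cs_normM : forall x y, `|cs_mul x y| <= `|x| * `|y|;
  cs_norm : forall x, `|cs_mul (cs_star x) x| = `|x| ^+ 2
}.

#[short(type="cstarAlgType")]
HB.structure Definition CStarAlgebra (R : realType) :=
  {A of CompleteNormedModule R[i] A & isCStarAlgebra R A}.

#[non_forgetful_inheritance]
HB.instance Definition _ (R : realType) (A : cstarAlgType R) :=
  GRing.Zmodule_isPzRing.Build (CStarAlgebra.sort A)
    cs_mulA cs_mul1l cs_mul1r cs_mulDl cs_mulDr.
#[non_forgetful_inheritance]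
HB.instance Definition _ (R : realType) (A : cstarAlgType R) :=
  isStarRing.Build (CStarAlgebra.sort A) cs_starK cs_starD cs_starM.

Section CStarAlgebraTheory.
Context {R : realType} {A : cstarAlgType R}.

Lemma cstar_scalerAl (c : R[i]) (x y : A) : c *: (x * y) = (c *: x) * y.
Proof. exact: cs_scalerAl. Qed.
Lemma cstar_scalerAr (c : R[i]) (x y : A) : c *: (x * y) = x * (c *: y).
Proof. exact: cs_scalerAr. Qed.
Lemma starZ (c : R[i]) (x : A) : star (c *: x) = c^* *: star x.
Proof. exact: cs_starZ. Qed.
Lemma cstar_normM (x y : A) : `|x * y| <= `|x| * `|y|.
Proof. exact: cs_normM. Qed.
Lemma cstar_norm (x : A) : `|star x * x| = `|x| ^+ 2.
Proof. exact: cs_norm. Qed.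

End CStarAlgebraTheory.

Definition projection (A : starRingType) (p : A) : Prop :=
  p * p = p /\ star p = p.

Definition lin_span (K : pzRingType) (V : lmodType K) (S : set V) : set V :=
  [set x | exists (n : nat) (c : 'I_n -> K) (s : 'I_n -> V),
      (forall i, S (s i)) /\ x = \sum_i c i *: s i].

Section CStar.
Context {R : realType}.
Implicit Type A : cstarAlgType R.

Lemma star0 (A : starRingType) : star (0 : A) = 0.
Proof. by apply: (addrI (star 0)); rewrite -starD !addr0. Qed.

Lemma starN (A : starRingType) (x : A) : star (- x) = - star x.
Proof. by apply: (addrI (star x)); rewrite -starD !subrr star0. Qed.

Lemma starB (A : starRingType) (x y : A) : star (x - y) = star x - star y.
Proof. by rewrite starD starN. Qed.

Lemma norm_star A (x : A) : `|star x| = `|x|.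
Proof.
have le_star (y : A) : `|y| <= `|star y|.
  have [->|y0] := eqVneq y 0; first by rewrite normr0.
  have ny0 : 0 < `|y| by rewrite normr_gt0.
  by rewrite -(ler_pM2r ny0) -expr2 -cstar_norm cstar_normM.
by apply: le_anti; rewrite le_star -{2}(starK x) le_star.
Qed.

(* A C*-subalgebra of A containing the unit of A. *)
Record unital_cstar_subalgebra A (P : set A) : Prop := {
  subalg_one : P 1;
  subalg_add : forall x y, P x -> P y -> P (x + y);
  subalg_scale : forall (c : R[i]) x, P x -> P (c *: x);
  subalg_mul : forall x y, P x -> P y -> P (x * y);
  subalg_star : forall x, P x -> P (star x);
  subalg_closed : closed P
}.

(* For a C*-subalgebra B of A; B = setT gives the LP property of A itself. *)
Definition has_LP A (B : set A) : Prop :=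
  B `<=` closure (lin_span [set p | B p /\ projection p]).

(* E : A -> P is represented as a map A -> A with values in P; positivity of an
   element of P is taken in P: it has the form y^* y with y in P.
   Contractivity follows from the other clauses (Tomiyama); it is part of the
   usual definition and is what makes the termwise E^oo well defined. *)
Record condExp A (P : set A) := CondExp {
  condExp_fun :> A -> A;
  condExp_in : forall x, P (condExp_fun x);
  condExp_id : forall p, P p -> condExp_fun p = p;
  condExp_linear : forall (c : R[i]) x y,
    condExp_fun (c *: x + y) = c *: condExp_fun x + condExp_fun y;
  condExp_mull : forall p x, P p -> condExp_fun (p * x) = p * condExp_fun x;
  condExp_mulr : forall p x, P p -> condExp_fun (x * p) = condExp_fun x * p;
  condExp_pos : forall x,
    exists2 y, P y & condExp_fun (star x * x) = star y * y;
  condExp_contractive : forall x, `|condExp_fun x| <= `|x|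
}.

Definition faithful A (P : set A) (E : condExp P) : Prop :=
  forall x, E (star x * x) = 0 -> x = 0.

Definition quasi_basis A (P : set A) (E : condExp P) n (u v : 'I_n -> A) :=
  forall a, a = \sum_i u i * E (v i * a) /\ a = \sum_i E (a * u i) * v i.

Definition finite_index A (P : set A) (E : condExp P) : Prop :=
  exists (n : nat) (u v : 'I_n -> A), quasi_basis E u v.

(* Index E; a junk value unless E has finite index. *)
Definition watatani_index A (P : set A) (E : condExp P) : A :=
  xget 0 [set c | exists (n : nat) (u v : 'I_n -> A),
    quasi_basis E u v /\ c = \sum_i u i * v i].

Lemma watatani_indexE A (P : set A) (E : condExp P) n (u v : 'I_n -> A) :
  quasi_basis E u v -> watatani_index E = \sum_i u i * v i.
Proof.
move=> uv; rewrite /watatani_index; case: xgetP; last first.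
  by move=> /(_ (\sum_i u i * v i)) []; exists n, u, v.
move=> _ -> [m [s [t [st ->]]]].
under eq_bigr => j _ do rewrite (uv (s j)).1 mulr_suml.
rewrite exchange_big /=; apply: eq_bigr => i _.
under eq_bigr => j _ do rewrite -mulrA.
by rewrite -mulr_sumr -(st (v i)).2.
Qed.

End CStar.

(* The algebra l^oo(N, A) of bounded sequences, as a *-subring of nat -> A. *)
Section Linf.
Context {R : realType} (A : cstarAlgType R).

Definition bounded_seq : {pred nat -> A} :=
  fun u => `[< exists M : R[i], forall n, `|u n| <= M >].

Lemma bounded_seqP (u : nat -> A) :
  reflect (exists M : R[i], forall n, `|u n| <= M) (u \in bounded_seq).
Proof. exact: asboolP. Qed.

Lemma bounded_seq_subring : subring_closed bounded_seq.
Proof.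
split=> [|u v /bounded_seqP[M uM] /bounded_seqP[N vN]|
          u v /bounded_seqP[M uM] /bounded_seqP[N vN]]; apply/bounded_seqP.
- by exists `|1 : A| => n.
- exists (M + N) => n; apply: (le_trans (ler_normB _ _)).
  exact: lerD.
- exists (M * N) => n; apply: (le_trans (cstar_normM _ _)).
  exact: ler_pM.
Qed.
HB.instance Definition _ :=
  GRing.isSubringClosed.Build (nat -> A) bounded_seq bounded_seq_subring.

Record linf := Linf {
  linf_val :> nat -> A;
  linf_valP : linf_val \in bounded_seq
}.
HB.instance Definition _ := [isSub for linf_val].
HB.instance Definition _ := [Choice of linf by <:].
HB.instance Definition _ := 
  GRing.SubChoice_isSubPzRing.Build _ _ linf bounded_seq_subring.

Lemma linf_bound (u : linf) : exists2 M : R[i], 0 < M & forall n, `|u n| <= M.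
Proof.
have /bounded_seqP[M uM] := linf_valP u.
have M0 : 0 <= M := le_trans (normr_ge0 _) (uM 0%N).
exists (M + 1); first by rewrite ltr_wpDl.
by move=> n; rewrite (le_trans (uM n)) // lerDl.
Qed.

Lemma linf_star_subproof (u : linf) : (fun n => star (u n)) \in bounded_seq.
Proof.
have [M _ uM] := linf_bound u.
by apply/bounded_seqP; exists M => n; rewrite norm_star.
Qed.
Definition linf_star (u : linf) : linf := Linf (linf_star_subproof u).

Lemma linf_starK : involutive linf_star.
Proof. by move=> u; apply/val_inj/funext => n /=; rewrite starK. Qed.
Lemma linf_starD : {morph linf_star : x y / x + y}.
Proof. by move=> u v; apply/val_inj/funext => n; exact: starD. Qed.
Lemma linf_starM x y : linf_star (x * y) = linf_star y * linf_star x.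
Proof. by apply/val_inj/funext => n; exact: starM. Qed.
HB.instance Definition _ :=
  isStarRing.Build linf linf_starK linf_starD linf_starM.

Lemma linf_const_subproof (a : A) : (fun=> a) \in bounded_seq.
Proof. by apply/bounded_seqP; exists `|a|. Qed.
Definition linf_const (a : A) : linf := Linf (linf_const_subproof a).

(* c_0(A), as a *-ideal of l^oo(N, A). *)
Definition c0 : {pred linf} := fun u => `[< u n @[n --> \oo] --> (0 : A) >].

Lemma c0P (u : linf) : reflect (u n @[n --> \oo] --> (0 : A)) (u \in c0).
Proof. exact: asboolP. Qed.

Lemma c0_zmod_closed : zmod_closed c0.
Proof.
split=> [|u v /c0P u0 /c0P v0]; apply/c0P; first exact: cvg_cst.
by rewrite -(subr0 (0 : A)); exact: cvgB.
Qed.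
HB.instance Definition _ := GRing.isZmodClosed.Build linf c0 c0_zmod_closed.

Lemma c0_dominated (M : R[i]) (u v : linf) : 0 < M ->
  (forall n, `|v n| <= M * `|u n|) -> u \in c0 -> v \in c0.
Proof.
move=> M0 uv /c0P u0; apply/c0P/cvgr0Pnorm_lt => e e0.
have eM : 0 < e / M by rewrite divr_gt0.
move/cvgr0Pnorm_lt : u0 => /(_ _ eM); apply: filterS => n un.
by rewrite (le_lt_trans (uv n)) // mulrC -ltr_pdivlMr.
Qed.

Lemma c0_mull (u v : linf) : v \in c0 -> u * v \in c0.
Proof.
have [M M0 uM] := linf_bound u.
apply: (c0_dominated M0) => n; apply: (le_trans (cstar_normM _ _)).
by rewrite ler_wpM2r.
Qed.

Lemma c0_mulr (u v : linf) : u \in c0 -> u * v \in c0.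
Proof.
have [M M0 vM] := linf_bound v.
apply: (c0_dominated M0) => n; apply: (le_trans (cstar_normM _ _)).
by rewrite mulrC ler_wpM2r.
Qed.

Lemma c0_star (u : linf) : u \in c0 -> star u \in c0.
Proof.
apply: (c0_dominated ltr01) => n.
by rewrite mul1r /= norm_star.
Qed.

(* A^oo := l^oo(N, A) / c_0(A), with its unital *-ring structure; its norm is
   not needed.  The library
   only makes the quotient by an ideal a ring in the commutative case. *)
Definition seq_alg := Quotient.quot c0.
HB.instance Definition _ := GRing.Zmodule.on seq_alg.

Definition to_seq_alg (u : linf) : seq_alg := \pi_(Quotient.quot c0) u.

Definition seq_alg_repr (x : seq_alg) : linf := @repr _ (Quotient.quot c0) x.

Lemma seq_alg_reprK x : to_seq_alg (seq_alg_repr x) = x.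
Proof. exact: reprK. Qed.

Lemma to_seq_alg_eqP (u v : linf) :
  reflect (to_seq_alg u = to_seq_alg v) (u - v \in c0).
Proof. by rewrite Quotient.idealrBE; exact: eqP. Qed.

Lemma to_seq_algD u v : to_seq_alg (u + v) = to_seq_alg u + to_seq_alg v.
Proof. exact: (Quotient.pi_add c0 u v). Qed.

Lemma repr_to_seq_alg (u : linf) : seq_alg_repr (to_seq_alg u) - u \in c0.
Proof. by apply/to_seq_alg_eqP; rewrite seq_alg_reprK. Qed.

Definition seq_alg_one : seq_alg := to_seq_alg 1.
Definition seq_alg_mul (x y : seq_alg) : seq_alg :=
  to_seq_alg (seq_alg_repr x * seq_alg_repr y).
Definition seq_alg_star (x : seq_alg) : seq_alg :=
  to_seq_alg (star (seq_alg_repr x)).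

Lemma seq_alg_mulE u v :
  seq_alg_mul (to_seq_alg u) (to_seq_alg v) = to_seq_alg (u * v).
Proof.
apply/to_seq_alg_eqP; set u' := seq_alg_repr _; set v' := seq_alg_repr _.
have -> : u' * v' - u * v = (u' - u) * v' + u * (v' - v).
  by rewrite mulrBl mulrBr addrA subrK.
by apply: rpredD; [apply: c0_mulr|apply: c0_mull]; exact: repr_to_seq_alg.
Qed.

Lemma seq_alg_starE u : seq_alg_star (to_seq_alg u) = to_seq_alg (star u).
Proof.
apply/to_seq_alg_eqP; rewrite -starB; apply: c0_star; exact: repr_to_seq_alg.
Qed.

Lemma seq_alg_ind (Q : seq_alg -> Prop) :
  (forall u, Q (to_seq_alg u)) -> forall x, Q x.
Proof. by move=> Qu x; rewrite -(seq_alg_reprK x). Qed.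

Lemma seq_alg_mulA : associative seq_alg_mul.
Proof.
elim/seq_alg_ind=> u; elim/seq_alg_ind=> v; elim/seq_alg_ind=> w.
by rewrite !seq_alg_mulE mulrA.
Qed.
Lemma seq_alg_mul1l : left_id seq_alg_one seq_alg_mul.
Proof. by elim/seq_alg_ind=> u; rewrite seq_alg_mulE mul1r. Qed.
Lemma seq_alg_mul1r : right_id seq_alg_one seq_alg_mul.
Proof. by elim/seq_alg_ind=> u; rewrite seq_alg_mulE mulr1. Qed.
Lemma seq_alg_mulDl : left_distributive seq_alg_mul +%R.
Proof.
elim/seq_alg_ind=> u; elim/seq_alg_ind=> v; elim/seq_alg_ind=> w.
by rewrite -to_seq_algD !seq_alg_mulE -to_seq_algD mulrDl.
Qed.
Lemma seq_alg_mulDr : right_distributive seq_alg_mul +%R.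
Proof.
elim/seq_alg_ind=> u; elim/seq_alg_ind=> v; elim/seq_alg_ind=> w.
by rewrite -to_seq_algD !seq_alg_mulE -to_seq_algD mulrDr.
Qed.
HB.instance Definition _ := GRing.Zmodule_isPzRing.Build seq_alg
  seq_alg_mulA seq_alg_mul1l seq_alg_mul1r seq_alg_mulDl seq_alg_mulDr.

Lemma seq_alg_starK : involutive seq_alg_star.
Proof. by elim/seq_alg_ind=> u; rewrite !seq_alg_starE starK. Qed.
Lemma seq_alg_starD : {morph seq_alg_star : x y / x + y}.
Proof.
elim/seq_alg_ind=> u; elim/seq_alg_ind=> v.
by rewrite -to_seq_algD !seq_alg_starE starD to_seq_algD.
Qed.
Lemma seq_alg_starM (x y : seq_alg) :
  seq_alg_star (x * y) = seq_alg_star y * seq_alg_star x.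
Proof.
move: x y; elim/seq_alg_ind=> u; elim/seq_alg_ind=> v.
rewrite [_ * to_seq_alg v]seq_alg_mulE !seq_alg_starE starM.
by rewrite [RHS]seq_alg_mulE.
Qed.
HB.instance Definition _ :=
  isStarRing.Build seq_alg seq_alg_starK seq_alg_starD seq_alg_starM.

Definition seq_alg_const (a : A) : seq_alg := to_seq_alg (linf_const a).

(* A_oo = A^oo \cap A' *)
Definition central_seq_alg : set seq_alg :=
  [set x | forall a : A, x * seq_alg_const a = seq_alg_const a * x].

(* E^oo : A^oo -> P^oo, where P^oo is regarded as a subset of A^oo; it does not
   depend on the representing sequence, see [condExp_seqE]. *)
Section CondExpSeq.
Variables (P : set A) (E : condExp P).

Lemma condExp_linf_subproof (u : linf) : (fun n => E (u n)) \in bounded_seq.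
Proof.
have [M _ uM] := linf_bound u; apply/bounded_seqP; exists M => n.
exact: le_trans (condExp_contractive E _) (uM n).
Qed.
Definition condExp_linf (u : linf) : linf := Linf (condExp_linf_subproof u).

Definition condExp_seq (x : seq_alg) : seq_alg :=
  to_seq_alg (condExp_linf (seq_alg_repr x)).

Lemma condExpB x y : E (x - y) = E x - E y.
Proof.
by rewrite addrC -scaleN1r condExp_linear scaleN1r addrC.
Qed.

Lemma condExp_seqE (u : linf) :
  condExp_seq (to_seq_alg u) = to_seq_alg (condExp_linf u).
Proof.
apply/to_seq_alg_eqP.
apply: (c0_dominated ltr01) (repr_to_seq_alg u) => n.
rewrite mul1r.
have -> : (condExp_linf (seq_alg_repr (to_seq_alg u)) - condExp_linf u) n =
    E ((seq_alg_repr (to_seq_alg u) - u) n) by rewrite condExpB.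
exact: condExp_contractive.
Qed.

End CondExpSeq.
End Linf.

Arguments seq_alg {R} A.
Arguments central_seq_alg {R} A.

Definition is_inverse (A : pzRingType) (x y : A) : Prop := x * y = 1 /\ y * x = 1.

(* g is (Index E)^-1. *)
Definition rokhlin_property (R : realType) (A : cstarAlgType R) (P : set A)
    (E : condExp P) : Prop :=
  exists e : seq_alg A,
    [/\ projection e, central_seq_alg A e,
        exists2 g : A, is_inverse (watatani_index E) g
                     & condExp_seq E e = seq_alg_const g
      & injective (fun x : A => seq_alg_const x * e)].

(* Main.v *)
(* Let [c = Index E] and let [e] be the Rokhlin projection.  The map
   [T x = e x - c e E^oo(e x)] on [A^oo] is a projection of the Hilbert module
   attached to [E^oo], and [\sum_i T(u_i) v_i = 0] for a quasi-basis [(u, v)].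
   Expanding, [\sum_(k,i) t_k E(u_k^* u_i) t_i^* = 0] with [t_k = T(v_k^* )].
   Since [E] is completely positive, Cauchy-Schwarz for [(E(u_k^* u_i))] gives
   [T(u_k) = \sum_i t_i E(u_i^* u_k) = 0], that is [e x = c e E^oo(e x)] for all
   [x].  Hence [p |-> c E^oo(e p)] maps projections of [A] to projections of
   [P^oo], which lift termwise to projections of [P]; being linear, bounded, and
   the identity on [P], it carries approximations of elements of [P] by
   combinations of projections of [A] to approximations by projections of [P].
   The order theory of C*-algebras that this needs is derived from the square
   root of [1 - k], [|k| <= 1], without any spectral theory. *)
Require Import Defs.
From mathcomp Require Import all_boot all_order all_algebra complex.
From mathcomp Require Import boolp classical_sets.
From mathcomp Require Import reals topology normedtype sequences.
From mathcomp Require Import lra ring.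
Import Order.TTheory GRing.Theory Num.Theory.
Import numFieldTopology.Exports numFieldNormedType.Exports.

Set Implicit Arguments.
Unset Strict Implicit.
Unset Printing Implicit Defensive.

(** * The real-valued norm and limits *)

Section RealNorm.
Local Open Scope classical_set_scope.
Local Open Scope ring_scope.
Local Open Scope complex_scope.
Context {R : realType} {A : cstarAlgType R}.
Implicit Types (x y z k l : A) (r s t e : R).

(** The norm takes nonnegative values in [R[i]]; its real part carries the same information and puts
    the estimates in the ordered field [R]. *)
Definition nrm x : R := complex.Re `|x|.

Lemma nrmE x : `|x| = (nrm x)%:C.
Proof. by rewrite /nrm RRe_real ?ger0_real ?normr_ge0. Qed.

Lemma nrm_ge0 x : 0 <= nrm x.
Proof. by rewrite -ler0c -nrmE normr_ge0. Qed.

Lemma nrmD x y : nrm (x + y) <= nrm x + nrm y.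
Proof. by rewrite -lecR rmorphD /= -!nrmE ler_normD. Qed.

Lemma nrmN x : nrm (- x) = nrm x.
Proof. by rewrite /nrm normrN. Qed.

Lemma nrmBC x y : nrm (x - y) = nrm (y - x).
Proof. by rewrite -nrmN opprB. Qed.

Lemma nrmM x y : nrm (x * y) <= nrm x * nrm y.
Proof. by rewrite -lecR rmorphM /= -!nrmE cstar_normM. Qed.

Lemma nrm0 : nrm 0 = 0.
Proof. by rewrite /nrm normr0. Qed.

Lemma nrm0_eq0 x : nrm x = 0 -> x = 0.
Proof. by move=> x0; apply/eqP; rewrite -normr_eq0 nrmE x0. Qed.

Lemma nrm_star x : nrm (star x) = nrm x.
Proof. by rewrite /nrm norm_star. Qed.

Lemma nrm_starM x : nrm (star x * x) = nrm x ^+ 2.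
Proof. by apply: complexI; rewrite rmorphXn /= -!nrmE cstar_norm. Qed.

Lemma nrm_sqr x : star x = x -> nrm (x * x) = nrm x ^+ 2.
Proof. by move=> xE; rewrite -nrm_starM xE. Qed.

Lemma nrmZ (c : R[i]) x : nrm (c *: x) = complex.Re `|c| * nrm x.
Proof.
apply: complexI; rewrite rmorphM /= -!nrmE normrZ; congr (_ * _).
Qed.

Lemma nrmZr r x : nrm (r%:C *: x) = `|r| * nrm x.
Proof. by rewrite nrmZ normc_def /= expr0n /= addr0 sqrtr_sqr. Qed.

Lemma star1 : star 1 = 1 :> A.
Proof. by rewrite -[LHS]mulr1 -{2}(starK 1) -starM mulr1 starK. Qed.

(** The C*-identity makes this norm equal to its own square. Only an inequality can be claimed,
    since the zero algebra is allowed. *)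
Lemma nrm1_le1 : nrm (1 : A) <= 1.
Proof.
have := nrm_sqr star1; have := nrm_ge0 (1 : A); rewrite mulr1; nra.
Qed.

Lemma starZr r x : star (r%:C *: x) = r%:C *: star x.
Proof. by rewrite starZ; congr (_ *: _); exact: conjc_real. Qed.

Definition tends (u : nat -> A) l :=
  forall e, 0 < e -> exists N, forall n, (N <= n)%N -> nrm (u n - l) < e.

Lemma cvg_tends (u : nat -> A) l : u n @[n --> \oo] --> l <-> tends u l.
Proof.
split.
  move=> /cvgrPdist_lt ul e e0.
  have /ul [N _ uN] : 0 < e%:C by rewrite ltcR.
  by exists N => n /uN /=; rewrite nrmE ltcR nrmBC.
move=> ul; apply/cvgrPdist_lt => e e0.
have ei : e = (complex.Re e)%:C by rewrite RRe_real // gtr0_real.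
have /ul [N uN] : 0 < complex.Re e by rewrite -ltcR -ei.
by exists N => // n /uN /=; rewrite ei nrmE ltcR nrmBC.
Qed.

Lemma closed_tends (S : set A) (u : nat -> A) l :
  closed S -> (forall n, S (u n)) -> tends u l -> S l.
Proof.
move=> cS Su /cvg_tends ul; rewrite (closure_id S).1 //.
move=> B /ul [N _ /(_ N)] /=; rewrite leqnn => /(_ isT) BuN.
by exists (u N).
Qed.

Lemma closureP (S : set A) x :
  closure S x <-> forall e, 0 < e -> exists2 y, S y & nrm (x - y) < e.
Proof.
split.
  move=> Sx e e0.
  have e0' : 0 < e%:C by rewrite ltcR.
  have [y [Sy]] := Sx _ (nbhsx_ballx x _ e0').
  rewrite -ball_normE /= nrmE ltcR; by exists y.
move=> h B /nbhs_ballP [e /= e0 eB].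
have ei : e = (complex.Re e)%:C by rewrite RRe_real // gtr0_real.
have /h [y Sy xy] : 0 < complex.Re e by rewrite -ltcR -ei.
exists y; split => //; apply: eB.
by rewrite -ball_normE /= nrmE ei ltcR.
Qed.

(** Telescoping bounds the increments of [u] by those of [s], which is nondecreasing and bounded,
    hence convergent; so [u] is Cauchy and completeness applies. *)
Lemma majorant_tends (u : nat -> A) (s : nat -> R) M :
  (forall n, nrm (u n.+1 - u n) <= s n.+1 - s n) -> (forall n, s n <= M) ->
  exists l, tends u l.
Proof.
move=> us sM.
have s_nd : {homo s : m n / (m <= n)%N >-> m <= n}.
  apply: homo_leq => [//|? ? ?|n]; first exact: le_trans.
  by rewrite -subr_ge0; apply: le_trans (us n); exact: nrm_ge0.
have us' m n : (m <= n)%N -> nrm (u n - u m) <= s n - s m.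
  elim: n => [|n IH]; first by rewrite leqn0 => /eqP ->; rewrite !subrr nrm0.
  rewrite leq_eqVlt => /orP[/eqP <-|mn]; first by rewrite !subrr nrm0.
  have -> : u n.+1 - u m = (u n.+1 - u n) + (u n - u m) by rewrite addrA subrK.
  have := nrmD (u n.+1 - u n) (u n - u m); have := us n.
  have := IH mn; lra.
have s_cvg : cvgn s.
  by apply: nondecreasing_is_cvgn => //; exists M => _ [n _ <-].
suff /cauchy_cvg u_cvg : cauchy (u @ \oo).
  by exists (limn u); apply/cvg_tends.
apply: cauchy_exP => e e0.
have ei : e = (complex.Re e)%:C by rewrite RRe_real // gtr0_real.
move: e0; rewrite ei ltcR => d0.
have /cvgrPdist_lt /(_ (complex.Re e / 4)) : s @ \oo --> limn s by [].
case=> [|N _ sN]; first lra.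
exists (u N), N => // n /= Nn; rewrite -ball_normE /= nrmE ltcR nrmBC.
have := sN n Nn; have := sN N (leqnn N); have := us' N n Nn.
rewrite /= !ltr_norml; lra.
Qed.

End RealNorm.

(** * Square roots *)

Section Sqrt.
Local Open Scope ring_scope.
Local Open Scope complex_scope.
Context {R : realType} {A : cstarAlgType R}.
Implicit Types (x y z k l : A) (r s t e : R).

Lemma nrm_le x y : nrm x <= nrm (x - y) + nrm y.
Proof. by have := nrmD (x - y) y; rewrite subrK. Qed.

Lemma tends_cst x : tends (fun=> x) x.
Proof. by move=> e e0; exists 0%N => n _; rewrite subrr nrm0. Qed.

Lemma tends_shift (u : nat -> A) l : tends u l -> tends (fun n => u n.+1) l.
Proof.
by move=> ul e /ul[N uN]; exists N => n Nn; apply: uN; exact: leqW.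
Qed.

Lemma tends_uniq (u : nat -> A) l m : tends u l -> tends u m -> l = m.
Proof.
move=> ul um; apply/eqP; rewrite -subr_eq0; apply/eqP/nrm0_eq0.
apply/eqP; rewrite eq_le nrm_ge0 andbT leNgt; apply/negP => lm0.
have e0 : 0 < nrm (l - m) / 2 by lra.
have [N uN] := ul _ e0; have [M uM] := um _ e0.
have := uN _ (leq_maxl N M); have := uM _ (leq_maxr N M).
set n := maxn N M => h1; rewrite nrmBC => h2.
have := nrmD (l - u n) (u n - m); rewrite addrA subrK; lra.
Qed.

Lemma tendsD (u v : nat -> A) l m :
  tends u l -> tends v m -> tends (fun n => u n + v n) (l + m).
Proof.
move=> ul vm e e0; have e2 : 0 < e / 2 by lra.
have [N uN] := ul _ e2; have [M vM] := vm _ e2.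
exists (maxn N M) => n; rewrite geq_max => /andP[/uN h1 /vM h2].
have := nrmD (u n - l) (v n - m); rewrite addrACA opprD; lra.
Qed.

Lemma tendsM (u v : nat -> A) l m :
  tends u l -> tends v m -> tends (fun n => u n * v n) (l * m).
Proof.
move=> ul vm e e0.
have a0 : 0 < nrm m + 1 by have := nrm_ge0 m; lra.
have b0 : 0 < nrm l + 1 by have := nrm_ge0 l; lra.
have [N uN] := ul _ (divr_gt0 (divr_gt0 e0 (ltr0Sn R 1)) a0).
have [M vM] := vm _ (divr_gt0 (divr_gt0 e0 (ltr0Sn R 1)) b0).
have [K vK] := vm _ ltr01.
exists (maxn N (maxn M K)) => n; rewrite !geq_max.
move=> /and3P[/uN h1 /vM h2 /vK h3].
have -> : u n * v n - l * m = (u n - l) * v n + l * (v n - m).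
  by rewrite mulrBl mulrBr addrA subrK.
apply: le_lt_trans (nrmD _ _) _.
have h4 := nrmM (u n - l) (v n); have h5 := nrmM l (v n - m).
have h6 := nrm_le (v n) m.
move: h1 h2; rewrite !ltr_pdivlMr // => h1 h2.
have h7 : nrm (u n - l) * nrm (v n) <= nrm (u n - l) * (nrm m + 1).
  by apply: ler_wpM2l; [exact: nrm_ge0|lra].
have h8 : nrm l * nrm (v n - m) <= nrm (v n - m) * (nrm l + 1).
  by have := nrm_ge0 (v n - m); lra.
lra.
Qed.

Lemma tendsZ r (u : nat -> A) l :
  tends u l -> tends (fun n => r%:C *: u n) (r%:C *: l).
Proof.
move=> /(tendsM (tends_cst (r%:C *: (1 : A)))) h e /h[N uN]; exists N => n /uN.
by rewrite -!cstar_scalerAl !mul1r.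
Qed.

Lemma tends_star (u : nat -> A) l :
  tends u l -> tends (fun n => star (u n)) (star l).
Proof.
by move=> ul e /ul[N uN]; exists N => n /uN; rewrite -starB nrm_star.
Qed.

Lemma tends_nrm_le (u : nat -> A) l r :
  tends u l -> (forall n, nrm (u n) <= r) -> nrm l <= r.
Proof.
move=> ul ur; apply/ler_addgt0Pr => e /ul[N /(_ N (leqnn N))].
rewrite nrmBC; have := nrm_le l (u N); have := ur N; lra.
Qed.

Lemma subalgB (P : set A) x y : unital_cstar_subalgebra P ->
  P x -> P y -> P (x - y).
Proof.
move=> hP Px Py; rewrite -scaleN1r; apply: subalg_add => //.
exact: subalg_scale.
Qed.

Lemma subalg_0 (P : set A) : unital_cstar_subalgebra P -> P 0.
Proof.
by move=> hP; have P1 := subalg_one hP; rewrite -(subrr 1); exact: subalgB.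
Qed.

Lemma subalg_sum (P : set A) n (F : 'I_n -> A) : unital_cstar_subalgebra P ->
  (forall i, P (F i)) -> P (\sum_i F i).
Proof.
move=> hP PF; apply: (big_ind P) => [|x y|//]; first exact: subalg_0.
exact: subalg_add.
Qed.

Lemma half_double x : (2^-1)%:C *: (x + x) = x.
Proof.
rewrite scalerDr -scalerDl -rmorphD /= (_ : 2^-1 + 2^-1 = 1) ?scale1r //.
by lra.
Qed.

(* Iterates of [z |-> (k + z^2) / 2], dominated by those of
   [s |-> (1 + s^2) / 2], which increase to 1. *)
Lemma sqrt_1B k : star k = k -> nrm k <= 1 ->
  exists z, [/\ star z = z, nrm z <= nrm k, (1 - z) * (1 - z) = 1 - k,
    (forall x, x * k = k * x -> x * z = z * x)
    & forall P : set A, unital_cstar_subalgebra P -> P k -> P z].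
Proof.
move=> kE k1.
pose f z : A := (2^-1)%:C *: (k + z * z).
pose u n := iter n f 0.
pose s n := iter n (fun s : R => (1 + s ^+ 2) / 2) 0.
have sS n : s n.+1 = (1 + s n ^+ 2) / 2 by [].
  (* Each iterate is a polynomial in [k], so it commutes with whatever commutes with [k]; in
     particular the iterates commute with one another. *)
  have uC x : x * k = k * x -> forall n, x * u n = u n * x.
  move=> xk; elim=> [|n IH]; first by rewrite mulr0 mul0r.
  rewrite /= -/(u n) /f -cstar_scalerAr -cstar_scalerAl mulrDl mulrDr xk.
  by rewrite mulrA IH -mulrA IH mulrA.
have uk n : u n * k = k * u n by rewrite [RHS]uC.
have uu m n : u m * u n = u n * u m by apply: uC; rewrite uk.
have s01 n : 0 <= s n <= 1.
  elim: n => [|n]; first by rewrite /= lexx ler01.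
  by rewrite /= -/(s n) => /andP[h1 h2]; apply/andP; split; nra.
have us n : nrm (u n) <= s n.
  elim: n => [|n IH]; first by rewrite /= nrm0.
  rewrite /= -/(u n) -/(s n) /f nrmZr ger0_norm ?invr_ge0 ?ler0n //.
  have := nrmD k (u n * u n); have := nrmM (u n) (u n); have := nrm_ge0 (u n).
  have /andP[? ?] := s01 n; nra.
have uk1 n : nrm (u n) <= nrm k.
  elim: n => [|n IH]; first by rewrite /= nrm0 nrm_ge0.
  rewrite /= -/(u n) /f nrmZr ger0_norm ?invr_ge0 ?ler0n //.
  have := nrmD k (u n * u n); have := nrmM (u n) (u n); have := nrm_ge0 (u n).
  nra.
have uD n : nrm (u n.+1 - u n) <= s n.+1 - s n.
  elim: n => [|n IH].
    rewrite /= /f !mulr0 !subr0 addr0 nrmZr expr0n /= addr0.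
    rewrite ger0_norm ?invr_ge0 ?ler0n //; lra.
  (* Because the iterates commute, the difference of two squares factors exactly as it does for the
     scalar iteration [s]. *)
  have -> : u n.+2 - u n.+1 =
      (2^-1)%:C *: ((u n.+1 - u n) * (u n.+1 + u n)).
    rewrite [u n.+2]/= -/(u n) -/(f (u n)) {1}/f -/(u n.+1).
    rewrite {2}[u n.+1]/= -/(u n) {2}/f -scalerBr opprD addrACA subrr add0r.
    by congr (_ *: _); rewrite mulrDr !mulrBl (uu n.+1 n) addrA subrK.
  rewrite nrmZr ger0_norm ?invr_ge0 ?ler0n //.
  have := nrmM (u n.+1 - u n) (u n.+1 + u n).
  have h1 := nrmD (u n.+1) (u n); have h2 := us n; have h3 := us n.+1.
  have h0 := nrm_ge0 (u n.+1 + u n); have h0' := nrm_ge0 (u n.+1 - u n).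
  have -> : s n.+2 - s n.+1 = ((s n.+1 - s n) * (s n.+1 + s n)) / 2.
    rewrite (sS n.+1) {2}(sS n); lra.
  have : nrm (u n.+1 - u n) * nrm (u n.+1 + u n) <=
    (s n.+1 - s n) * (s n.+1 + s n) by apply: ler_pM => //; lra.
  lra.
have [|z uz] := majorant_tends (M := 1) uD.
  by move=> n; case/andP: (s01 n).
have zE : z = f z.
  apply: (tends_uniq (tends_shift uz)); apply: tendsZ; apply: tendsD.
    exact: tends_cst.
  exact: tendsM.
have zz : z + z = k + z * z.
  by rewrite {1 2}zE /f -scalerDr half_double.
exists z; split.
- apply: (tends_uniq (tends_star uz)).
  have uE n : star (u n) = u n.
    elim: n => [|n IH]; first by rewrite /= star0.
    by rewrite /= -/(u n) /f starZr starD starM kE IH.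
  by move=> e /uz[N uN]; exists N => n; rewrite uE; exact: uN.
- exact: tends_nrm_le uz uk1.
- have -> : k = z + z - z * z by rewrite zz addrK.
  rewrite opprB.
  by rewrite mulrBl mul1r mulrBr mulr1 opprB -addrA (addrCA (- z)) -opprD.
- move=> x xk; apply: (tends_uniq (tendsM (tends_cst x) uz)).
  move=> e /(tendsM uz (tends_cst x))[N uN]; exists N => n.
  by rewrite uC //; exact: uN.
- move=> P hP Pk; apply: (closed_tends (Defs.subalg_closed hP) _ uz).
  elim=> [|n IH]; first exact: subalg_0.
  by apply: subalg_scale => //; apply: subalg_add => //; exact: subalg_mul.
Qed.

End Sqrt.

(** * Positive elements *)

Section Positive.
Local Open Scope ring_scope.
Local Open Scope complex_scope.
Context {R : realType} {A : cstarAlgType R}.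
Implicit Types (a b x y z k h : A) (r s t e : R).

(* For self-adjoint [h], a bound [`|t - h| <= t] says that the spectrum of [h]
   lies in [[0, 2t]]. *)
Definition pos h : Prop :=
  star h = h /\ exists2 t : R, 0 <= t & nrm (t%:C *: (1 : A) - h) <= t.

Lemma scalerMM (c d : R[i]) x y : (c *: x) * (d *: y) = (c * d) *: (x * y).
Proof. by rewrite -cstar_scalerAl -cstar_scalerAr scalerA. Qed.

Lemma scalerMMr r s x y : (r%:C *: x) * (s%:C *: y) = (r * s)%:C *: (x * y).
Proof. by rewrite scalerMM rmorphM. Qed.

Lemma scalerAr r s x : r%:C *: (s%:C *: x) = (r * s)%:C *: x.
Proof. by rewrite scalerA rmorphM. Qed.

Lemma nrmZ_ge0 r x : 0 <= r -> nrm (r%:C *: x) = r * nrm x.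
Proof. by move=> r0; rewrite nrmZr ger0_norm. Qed.

Lemma pos_gt0 h : pos h ->
  exists2 t : R, 0 < t & nrm (t%:C *: (1 : A) - h) <= t.
Proof.
move=> [_ [t t0 ht]]; exists (t + 1); first lra.
have -> : (t + 1)%:C *: (1 : A) - h = (t%:C *: (1 : A) - h) + 1.
  by rewrite rmorphD scalerDl scale1r addrAC.
have := nrmD (t%:C *: (1 : A) - h) 1; have := nrm1_le1 (A := A); lra.
Qed.

(** After rescaling, [h = t (1 - k)] with [k] of norm at most 1, so the root is [sqrt t] times the
    root [1 - z] of [1 - k]. The last two clauses stand in for the functional calculus. *)
Lemma pos_sqrt h : pos h -> exists q, [/\ star q = q, pos q, q * q = h,
    (forall x, x * h = h * x -> x * q = q * x)
    & forall P : set A, unital_cstar_subalgebra P -> P h -> P q].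
Proof.
move=> hp; have hE := hp.1; have [t t0 ht] := pos_gt0 hp.
pose k := 1 - t^-1%:C *: h.
have tk : t%:C *: k = t%:C *: (1 : A) - h.
  by rewrite /k scalerBr scalerAr mulfV ?scale1r // gt_eqF.
have kE : star k = k by rewrite starB star1 starZr hE.
have k1 : nrm k <= 1.
  by rewrite -(ler_pM2l t0) -nrmZ_ge0 ?(ltW t0) // tk mulr1.
have [z [zE zk zz zC zP]] := sqrt_1B kE k1.
exists ((Num.sqrt t)%:C *: (1 - z)); split.
- by rewrite starZr starB star1 zE.
- split; first by rewrite starZr starB star1 zE.
  (* The difference between [sqrt t] and the root is [sqrt t] times [z], and [z] has norm at most
     1. *)
  exists (Num.sqrt t); first exact: sqrtr_ge0.
  rewrite -scalerBr subKr nrmZ_ge0 ?sqrtr_ge0 //.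
  by rewrite ler_piMr ?sqrtr_ge0 // (le_trans zk).
- by rewrite scalerMMr -expr2 sqr_sqrtr ?(ltW t0) // zz scalerBr tk subKr.
- move=> x xh; rewrite -cstar_scalerAr -cstar_scalerAl; congr (_ *: _).
  rewrite mulrBl mulrBr mulr1 mul1r zC // /k mulrBl mulrBr mulr1 mul1r.
  by rewrite -cstar_scalerAr -cstar_scalerAl xh.
- move=> P hP Ph; apply: subalg_scale => //; apply: subalgB => //.
    exact: subalg_one.
  apply: zP => //; apply: subalgB => //; first exact: subalg_one.
  exact: subalg_scale.
Qed.

Lemma star_cartesian x y : star x = x -> star y = y ->
  star (x + 'i *: y) = x - 'i *: y.
Proof.
move=> xE yE; rewrite starD starZ xE yE -scaleNr; congr (_ + _ *: _).
by apply/eqP; rewrite eq_complex /= oppr0 !eqxx.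
Qed.

(** For commuting self-adjoint [a] and [b], the element [w = a + i b] satisfies
    [star w * w = a * a + b * b], while [a] is the mean of [w] and [star w]. *)
Lemma comm_nrm a b : star a = a -> star b = b -> a * b = b * a ->
  nrm a ^+ 2 <= nrm (a * a + b * b).
Proof.
move=> aE bE ab; pose w := a + 'i *: b.
have wE : star w = a - 'i *: b by rewrite star_cartesian.
have -> : a * a + b * b = star w * w.
  rewrite wE /w mulrDr !mulrBl -cstar_scalerAl -cstar_scalerAr ab scalerMM.
  rewrite addrA subrK.
  have -> : ('i * 'i : R[i]) = -1 by rewrite -expr2 sqr_i.
  by rewrite scaleN1r opprK.
rewrite nrm_starM; have -> : a = (2^-1)%:C *: (w + star w).
  by rewrite wE /w addrACA subrr addr0 half_double.
rewrite nrmZ_ge0 ?invr_ge0 ?ler0n //.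
have := nrmD w (star w); rewrite nrm_star; have := nrm_ge0 (w + star w).
have := nrm_ge0 w; nra.
Qed.

(** With [k = a * a / t], the root [1 - z] of [1 - k] commutes with [a], and its square plus that of
    [a / sqrt t] is [1]; [comm_nrm] then bounds [1 - k]. *)
Lemma nrm_sub_sqr a t : star a = a -> 0 < t -> nrm a ^+ 2 <= t ->
  nrm (t%:C *: (1 : A) - a * a) <= t.
Proof.
move=> aE t0 at_.
pose k := t^-1%:C *: (a * a).
have kE : star k = k by rewrite starZr starM aE.
have tV0 : 0 <= t^-1 by rewrite invr_ge0 ltW.
have k1 : nrm k <= 1.
  by rewrite nrmZ_ge0 // nrm_sqr // mulrC ler_pdivrMr // mul1r.
have [z [zE _ zz zC _]] := sqrt_1B kE k1.
pose b := (Num.sqrt t^-1)%:C *: a.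
have bb : b * b = k by rewrite scalerMMr -expr2 sqr_sqrtr.
have rE : star (1 - z) = 1 - z by rewrite starB star1 zE.
have rb : (1 - z) * b = b * (1 - z).
  have az : a * z = z * a.
    by apply: zC; rewrite -cstar_scalerAr -cstar_scalerAl mulrA.
  by rewrite mulrBl mulrBr mul1r mulr1 -cstar_scalerAl -cstar_scalerAr az.
have bE : star b = b by rewrite starZr aE.
have := comm_nrm rE bE rb; rewrite zz bb subrK => h.
have -> : t%:C *: (1 : A) - a * a = t%:C *: (1 - k).
  by rewrite scalerBr scalerAr mulfV ?scale1r // gt_eqF.
rewrite nrmZ_ge0 ?(ltW t0) // -zz nrm_sqr //.
by rewrite ler_piMr ?(ltW t0) // (le_trans h) // nrm1_le1.
Qed.

Lemma pos_sq a : star a = a -> pos (a * a).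
Proof.
move=> aE; split; first by rewrite starM aE.
have h : 0 < nrm a ^+ 2 + 1 by have := sqr_ge0 (nrm a); lra.
exists (nrm a ^+ 2 + 1); first exact: ltW.
by apply: nrm_sub_sqr => //; lra.
Qed.

(** Writing [h] as a square shows that every positive [t] above the norm of [h] can serve in [pos],
    so that one constant works for a whole bounded family. *)
Lemma pos_nrm h t : pos h -> 0 < t -> nrm h <= t ->
  nrm (t%:C *: (1 : A) - h) <= t.
Proof.
move=> /pos_sqrt[r [rE _ <- _ _]] t0.
by rewrite nrm_sqr // => ?; exact: nrm_sub_sqr.
Qed.

Lemma posD a b : pos a -> pos b -> pos (a + b).
Proof.
move=> [aE [s s0 sa]] [bE [t t0 tb]]; split; first by rewrite starD aE bE.
exists (s + t); first exact: addr_ge0.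
rewrite rmorphD scalerDl opprD addrACA.
by apply: le_trans (nrmD _ _) _; exact: lerD.
Qed.

Lemma pos0 : pos 0.
Proof. by rewrite -(mulr0 0); apply: pos_sq; exact: star0. Qed.

Lemma posZ r a : 0 <= r -> pos a -> pos (r%:C *: a).
Proof.
move=> r0 [aE [t t0 ta]]; split; first by rewrite starZr aE.
exists (r * t); first exact: mulr_ge0.
by rewrite -scalerAr -scalerBr nrmZ_ge0 // ler_wpM2l.
Qed.

(** Approximants within distance 1 of [h] all satisfy the bound of [pos] with the single constant
    [nrm h + 1], and this bound passes to the limit. *)
Lemma pos_closed h : star h = h ->
  (forall e, 0 < e -> exists2 h', pos h' & nrm (h - h') <= e) -> pos h.
Proof.
move=> hE hh; split => //; have h0 := nrm_ge0 h.
exists (nrm h + 1); first by lra.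
apply/ler_addgt0Pr => e e0.
have [h' ph' hh'] : exists2 h', pos h' & nrm (h - h') <= Num.min e 1.
  by apply: hh; rewrite lt_min e0 ltr01.
move: hh'; rewrite le_min => /andP[he h1].
have h'1 : nrm h' <= nrm h + 1.
  by have := nrm_le h' h; rewrite nrmBC; lra.
have t0 : 0 < nrm h + 1 by lra.
have := pos_nrm ph' t0 h'1.
have -> : (nrm h + 1)%:C *: (1 : A) - h =
    (nrm h + 1)%:C *: (1 : A) - h' - (h - h').
  by rewrite opprB addrA subrK.
have := nrmD ((nrm h + 1)%:C *: (1 : A) - h') (- (h - h')); rewrite nrmN; lra.
Qed.

Lemma pos_nrm_sub h : star h = h -> pos ((nrm h)%:C *: (1 : A) - h).
Proof.
move=> hE; split; first by rewrite starB starZr star1 hE.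
by exists (nrm h); rewrite ?subKr // nrm_ge0.
Qed.

(** With [t] the norm of [a + b], the element [t - a = (t - (a + b)) + b] is positive. Its root [s]
    commutes with the root [r] of [a], and [r * r + s * s = t], so [comm_nrm] bounds [r]. *)
Lemma pos_mono a b : pos a -> pos b -> nrm a <= nrm (a + b).
Proof.
move=> pa pb; have pab := posD pa pb.
have := posD (pos_nrm_sub pab.1) pb; rewrite opprD addrA addrNK.
set t := nrm (a + b) => /pos_sqrt[s [sE _ ss sC _]].
have /pos_sqrt[r [rE _ rr rC _]] := pa.
have ar : a * r = r * a by rewrite -rr mulrA.
have rs : r * s = s * r.
  apply: sC; rewrite mulrBl mulrBr ar.
  by rewrite -cstar_scalerAl -cstar_scalerAr mulr1 mul1r.
have := comm_nrm rE sE rs; rewrite rr ss (addrC a) subrK.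
rewrite -{1}rr nrm_sqr // nrmZ_ge0 ?nrm_ge0 //.
by move=> h; apply: (le_trans h); rewrite ler_piMr ?nrm_ge0 ?nrm1_le1.
Qed.

(* With [y = a + i b], [y^* y + y y^* = 2 (a^2 + b^2)]. *)
Lemma pos_starM_addC y : pos (star y * y + y * star y).
Proof.
pose a := (2^-1)%:C *: (y + star y).
pose b := (- (2^-1)%:C * 'i) *: (y - star y).
have aE : star a = a by rewrite starZr starD starK addrC.
have bE : star b = b.
  rewrite starZ starB starK -[star y - y]opprB scalerN -scaleNr; congr (_ *: _).
  by apply/eqP; rewrite eq_complex /=; apply/andP; split; apply/eqP; ring.
have p2 : 0 <= 2 :> R by lra.
have := posZ p2 (posD (pos_sq aE) (pos_sq bE)).
rewrite !scalerMM.
have -> : (- (2^-1)%:C * 'i) * (- (2^-1)%:C * 'i) = - (2^-1 * 2^-1)%:C :> R[i].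
  by apply/eqP; rewrite eq_complex /=; apply/andP; split; apply/eqP; ring.
rewrite -rmorphM /= scaleNr -scalerBr scalerAr.
have -> : (y + star y) * (y + star y) - (y - star y) * (y - star y) =
    (star y * y + y * star y) + (star y * y + y * star y).
  set T := star y * y + y * star y.
  have -> : (y + star y) * (y + star y) = T + (y * y + star y * star y).
    rewrite mulrDl !mulrDr (addrC (star y * y)) addrACA addrC.
    by rewrite (addrC (y * _)).
  have -> : (y - star y) * (y - star y) = (y * y + star y * star y) - T.
    rewrite mulrBl !mulrBr opprB addrACA -opprD (addrC (y * star y)).
    by rewrite addrAC.
  by rewrite opprB addrACA subrr addr0.
by rewrite (_ : 2 * (2^-1 * 2^-1) = 2^-1 :> R) ?half_double //; field.
Qed.

(* Kaplansky's argument: if [y^* y = - z^2], put [w = y z]; then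
   [w w^* + w^* w = - ((y y^* )^2 + (z^2)^2)] is positive, so [y y^* = 0]. *)
Lemma starM_eqN_sqr y z : star z = z -> star y * y = - (z * z) -> y = 0.
Proof.
move=> zE yz; have := pos_starM_addC (y * z).
have yyE : star (y * star y) = y * star y by rewrite starM starK.
have zzE : star (z * z) = z * z by rewrite starM zE.
have -> : star (y * z) * (y * z) = - ((z * z) * (z * z)).
  rewrite starM zE -(mulrA z (star y)) (mulrA (star y)) yz.
  by rewrite mulNr mulrN !mulrA.
have -> : y * z * star (y * z) = - (y * star y * (y * star y)).
  rewrite starM zE (mulrA (y * z)) -(mulrA y z z) -[z * z]opprK -yz mulrN mulNr.
  by rewrite !mulrA.
rewrite -opprD => pN.
(* The positive element added here to the square of [y * star y] makes the sum zero, so monotonicity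
   of the norm annihilates that square. *)
have := pos_mono (pos_sq yyE) (posD (pos_sq zzE) pN).
rewrite addrA (addrC (y * star y * _)) subrr nrm0 nrm_sqr //.
rewrite -{1}(starK y) nrm_starM nrm_star => h.
by apply: nrm0_eq0; apply/eqP; rewrite -sqrf_eq0 -sqrf_eq0 eq_le h sqr_ge0.
Qed.

(** Let [k] be the root of [h * h], the absolute value of [h]. Since [h * (k - h) = - k * (k - h)],
    the element [y = x * (k - h)] has [star y * y = - z * z], so [y] and [z] vanish. Then [k] and
    [h] both annihilate [k - h], whose square is therefore zero, and [h = k] is positive. *)
Lemma pos_starM x : pos (star x * x).
Proof.
pose h := star x * x.
have hE : star h = h by rewrite starM starK.
have [k [kE pk kk kC _]] := pos_sqrt (pos_sq hE).
have hk : h * k = k * h by apply: kC; rewrite mulrA.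
have [q [qE _ qq qC _]] := pos_sqrt pk.
have qk : q * k = k * q by rewrite -qq mulrA.
have hq : h * q = q * h by apply: qC.
pose y := x * (k - h).
pose z := q * (k - h).
have qkh : q * (k - h) = (k - h) * q by rewrite mulrBl mulrBr qk hq.
have khE : star (k - h) = k - h by rewrite starB kE hE.
have zE : star z = z by rewrite starM khE qE -qkh.
have yz : star y * y = - (z * z).
  have hkh : h * (k - h) = - (k * (k - h)) by rewrite !mulrBr hk kk opprB.
  rewrite /y starM khE -mulrA (mulrA (star x)) -/h hkh mulrN /z {1}qkh.
  by rewrite -mulrA (mulrA q) qq.
have y0 := starM_eqN_sqr zE yz.
have z0 : z = 0.
  apply: nrm0_eq0; apply/eqP; rewrite -sqrf_eq0 -nrm_sqr //.
  by rewrite -[z * z]opprK -yz y0 mulr0 oppr0 nrm0.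
have kkh : k * (k - h) = 0 by rewrite -{1}qq -mulrA -/z z0 mulr0.
have kkE : k * k = k * h by apply/eqP; rewrite -subr_eq0 -mulrBr kkh.
have kh2 : (k - h) * (k - h) = 0.
  by rewrite mulrBl !mulrBr hk -kk kkE !subrr.
have kh0 : k - h = 0.
  by apply: nrm0_eq0; apply/eqP; rewrite -sqrf_eq0 -nrm_sqr // kh2 nrm0.
by have -> : star x * x = k by apply/eqP; rewrite eq_sym -subr_eq0 -/h kh0.
Qed.

End Positive.

(** * Complete positivity and Cauchy-Schwarz *)

Section CompletelyPositive.
Local Open Scope ring_scope.
Local Open Scope complex_scope.
Context {R : realType} {A : cstarAlgType R}.
Implicit Types (a b x y z k h : A) (r s t e : R).

(** The geometric series, generated by [b |-> 1 + k * b] and majorized by its scalar analogue. Its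
    partial sums stay in any closed subalgebra containing [k], hence so does the inverse. *)
Lemma neumann_inverse k : nrm k < 1 -> exists b,
  [/\ (1 - k) * b = 1, b * (1 - k) = 1
    & forall P : set A, unital_cstar_subalgebra P -> P k -> P b].
Proof.
move=> k1; have k0 := nrm_ge0 k.
pose u n := iter n (fun b : A => 1 + k * b) 0.
pose s n := iter n (fun s : R => 1 + nrm k * s) 0.
have uS n : u n.+1 = 1 + k * u n by [].
have sS n : s n.+1 = 1 + nrm k * s n by [].
have uk n : u n * k = k * u n.
  elim: n => [|n IH]; first by rewrite mul0r mulr0.
  by rewrite uS mulrDl mulrDr mul1r mulr1 -mulrA IH.
have s_le n : s n <= (1 - nrm k)^-1.
  elim: n => [|n IH]; first by rewrite /= invr_ge0; lra.
  rewrite sS; have d0 : 0 < 1 - nrm k by lra.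
  have : 1 + nrm k * (1 - nrm k)^-1 = (1 - nrm k)^-1 by field; lra.
  have := ler_wpM2l k0 IH; lra.
have uD n : nrm (u n.+1 - u n) <= s n.+1 - s n.
  elim: n => [|n IH]; first by rewrite /= !mulr0 !addr0 !subr0 nrm1_le1.
  have -> : u n.+2 - u n.+1 = k * (u n.+1 - u n).
    by rewrite (uS n.+1) {2}(uS n) opprD addrACA subrr add0r mulrBr.
  have -> : s n.+2 - s n.+1 = nrm k * (s n.+1 - s n).
    by rewrite (sS n.+1) {2}(sS n); lra.
  by apply: le_trans (nrmM _ _) _; exact: ler_wpM2l.
have [b ub] := majorant_tends uD s_le.
have bE : b = 1 + k * b.
  apply: (tends_uniq (tends_shift ub)); apply: (tendsD (tends_cst 1)).
  exact: (tendsM (tends_cst k)).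
have bk : b * k = k * b.
  apply: (tends_uniq (tendsM ub (tends_cst k))) => e.
  move=> /(tendsM (tends_cst k) ub)[N uN]; exists N => n.
  by rewrite uk; exact: uN.
have kb : (1 - k) * b = 1 by rewrite mulrBl mul1r {1}bE addrK.
exists b; split => //; first by rewrite mulrBr mulr1 bk {1}bE addrK.
move=> P hP Pk; apply: (closed_tends (Defs.subalg_closed hP) _ ub).
elim=> [|n IH]; first exact: subalg_0.
by apply: subalg_add => //; [exact: subalg_one|exact: subalg_mul].
Qed.

(** Factor [h + e = (t + e) (1 - k)], where [k = (t - h) / (t + e)] has norm at most
    [t / (t + e) < 1]. *)
Lemma pos_addr_inverse h e : pos h -> 0 < e -> exists b, [/\ star b = b,
  (h + e%:C *: (1 : A)) * b = 1, b * (h + e%:C *: (1 : A)) = 1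
  & forall P : set A, unital_cstar_subalgebra P -> P h -> P b].
Proof.
move=> [hE [t t0 ht]] e0; have te0 : 0 < t + e by lra.
have V0 : 0 <= (t + e)^-1 by rewrite invr_ge0 ltW.
pose k := (t + e)^-1%:C *: (t%:C *: (1 : A) - h).
have k1 : nrm k < 1.
  rewrite /k nrmZ_ge0 // mulrC ltr_pdivrMr // mul1r; lra.
have hk : h + e%:C *: (1 : A) = (t + e)%:C *: (1 - k).
  rewrite scalerBr /k scalerAr mulfV ?gt_eqF // scale1r rmorphD scalerDl opprB.
  by rewrite [RHS]addrC addrA subrK.
have [b0 [kb bk bP]] := neumann_inverse k1.
have te1 : (t + e) * (t + e)^-1 = 1 by rewrite mulfV ?gt_eqF.
pose b := (t + e)^-1%:C *: b0.
have hb : (h + e%:C *: (1 : A)) * b = 1.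
  by rewrite hk /b scalerMMr kb te1 scale1r.
have bh : b * (h + e%:C *: (1 : A)) = 1.
  by rewrite hk /b scalerMMr bk mulrC te1 scale1r.
exists b; split => //.
  have hE' : star (h + e%:C *: (1 : A)) = h + e%:C *: (1 : A).
    by rewrite starD starZr star1 hE.
  by rewrite -[LHS]mulr1 -hb mulrA -{1}hE' -starM hb star1 mul1r.
move=> P hP Ph; apply: subalg_scale => //; apply: bP => //.
apply: subalg_scale => //; apply: subalgB => //.
by apply: subalg_scale => //; exact: subalg_one.
Qed.

Lemma pos_conj h x : pos h -> pos (star x * (h * x)).
Proof.
move=> /pos_sqrt[q [qE _ <- _ _]].
have -> : star x * (q * q * x) = star (q * x) * (q * x).
  by rewrite starM qE !mulrA.
exact: pos_starM.
Qed.

(** The [A]-valued inner product of the Hilbert module of [n]-tuples. *)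
Definition dot n (v w : 'I_n -> A) : A := \sum_i star (v i) * w i.

Definition mxapp n (G : 'I_n -> 'I_n -> A) (v : 'I_n -> A) (i : 'I_n) : A :=
  \sum_j G i j * v j.

Lemma star_sum n (F : 'I_n -> A) : star (\sum_i F i) = \sum_i star (F i).
Proof. by apply: (big_morph _ (@starD A)); exact: star0. Qed.

Lemma dot_mxapp n (G : 'I_n -> 'I_n -> A) v w :
  (forall i j, star (G i j) = G j i) -> dot v (mxapp G w) = dot (mxapp G v) w.
Proof.
move=> GE; rewrite /dot.
under eq_bigr do rewrite mulr_sumr.
rewrite exchange_big /=; apply: eq_bigr => j _.
rewrite star_sum mulr_suml; apply: eq_bigr => i _.
by rewrite starM GE mulrA.
Qed.

Lemma star_dot n (v w : 'I_n -> A) : star (dot v w) = dot w v.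
Proof.
by rewrite star_sum; apply: eq_bigr => i _; rewrite starM starK.
Qed.

(** Splits the quadratic form along the first coordinate, in preparation for completing the square
    in [v ord0]. *)
Lemma dot_mxapp_recl n (G : 'I_n.+1 -> 'I_n.+1 -> A) (v : 'I_n.+1 -> A) :
  (forall i j, star (G i j) = G j i) ->
  let q := \sum_j G ord0 (lift ord0 j) * v (lift ord0 j) in
  let v' := fun j => v (lift ord0 j) in
  dot v (mxapp G v) =
  star (v ord0) * (G ord0 ord0 * v ord0) + star (v ord0) * q + star q * v ord0
  + dot v' (mxapp (fun i j => G (lift ord0 i) (lift ord0 j)) v').
Proof.
move=> GE q v'.
have mS i : mxapp G v i = G i ord0 * v ord0 +
    \sum_j G i (lift ord0 j) * v (lift ord0 j) by rewrite /mxapp big_ord_recl.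
rewrite /dot big_ord_recl.
under eq_bigr do rewrite mS mulrDr.
rewrite mS big_split mulrDr -!addrA; congr (_ + (_ + (_ + _))).
rewrite star_sum mulr_suml; apply: eq_bigr => i _.
by rewrite starM GE mulrA.
Qed.

(* Block elimination of the first row and column of [G + e]. *)
Lemma completely_positive (P : set A) n (G : 'I_n -> 'I_n -> A) :
  unital_cstar_subalgebra P -> (forall i j, P (G i j)) ->
  (forall i j, star (G i j) = G j i) ->
  (forall v, (forall i, P (v i)) -> pos (dot v (mxapp G v))) ->
  forall v, pos (dot v (mxapp G v)).
Proof.
move=> hP; elim: n G => [|n IH] G PG GE Gpos v.
  by rewrite /dot big_ord0; exact: pos0.
pose ext (x : A) (w : 'I_n -> A) i := oapp w x (unlift ord0 i).
have ext0 x w : ext x w ord0 = x by rewrite /ext unlift_none.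
have extS x w : (fun j => ext x w (lift ord0 j)) = w.
  by apply/funext => j; rewrite /ext liftK.
have Pext x w : P x -> (forall i, P (w i)) -> forall i, P (ext x w i).
  by move=> Px Pw i; rewrite /ext; case: unliftP => [j _|_] /=.
pose g := G ord0 ord0.
pose q (w : 'I_n -> A) := \sum_j G ord0 (lift ord0 j) * w j.
pose G1 i j := G (lift ord0 i) (lift ord0 j).
have dotE x w : dot (ext x w) (mxapp G (ext x w)) =
    star x * (g * x) + star x * q w + star (q w) * x + dot w (mxapp G1 w).
  rewrite dot_mxapp_recl //= ext0 extS.
  have -> // : \sum_j G ord0 (lift ord0 j) * ext x w (lift ord0 j) = q w.
  by apply: eq_bigr => j _; rewrite /ext liftK.
have vE : v = ext (v ord0) (fun j => v (lift ord0 j)).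
  by apply/funext => i; rewrite /ext; case: unliftP => [j ->|->].
have gpos : pos g.
  have := Gpos (ext 1 (fun=> 0)) (Pext _ _ (subalg_one hP) (fun=> subalg_0 hP)).
  rewrite dotE star1 !mul1r mulr1.
  have -> : q (fun=> 0) = 0 by rewrite /q big1 // => j _; rewrite mulr0.
  rewrite /dot big1 ?star0 ?mul0r ?mulr0 ?addr0 // => j _ /=.
  by rewrite mul0r.
(* Adding [e] to the first diagonal entry makes it invertible; the perturbation is removed at the
   end by closedness of the positive cone. *)
have key e w x : 0 < e ->
    pos (dot (ext x w) (mxapp G (ext x w)) + e%:C *: (star x * x)).
  move=> e0; have [b [bE ab ba bP]] := pos_addr_inverse gpos e0.
  set a := g + _ in ab ba.
  have Pb : P b by apply: bP => //; exact: PG.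
  (* [G2] is the Schur complement of the perturbed corner entry [a = g + e], whose inverse is [b].
     Its entries stay in [P], so the induction hypothesis can apply to it. *)
  pose G2 i j := G1 i j - G (lift ord0 i) ord0 * (b * G ord0 (lift ord0 j)).
  have dot2 (y : 'I_n -> A) :
      dot y (mxapp G2 y) = dot y (mxapp G1 y) - star (q y) * (b * q y).
    rewrite /dot (eq_bigr (fun i => star (y i) * mxapp G1 y i -
      star (G ord0 (lift ord0 i) * y i) * (b * q y))); last first.
      move=> i _; rewrite starM GE -mulrA -mulrBr; congr (_ * _).
      rewrite /q !mulr_sumr -sumrB; apply: eq_bigr => j _.
      by rewrite mulrBl !mulrA.
    by rewrite sumrB -mulr_suml star_sum.
  have pos2 : forall y : 'I_n -> A, pos (dot y (mxapp G2 y)).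
    apply: IH.
    - move=> i j; apply: (subalgB hP); first exact: PG.
      by apply: (subalg_mul hP) => //; exact: (subalg_mul hP).
    - by move=> i j; rewrite /G2 /G1 starB !starM !GE bE mulrA.
    - move=> y Py; rewrite dot2.
      have Pq : P (q y) by apply: subalg_sum => // j; exact: subalg_mul.
      (* At the first coordinate [- b * q y] the completed square vanishes, so the perturbed form
         there equals the form of [G2] at [y]. This vector has entries in [P], where positivity is
         assumed. *)
      have Px : P (- (b * q y)).
        rewrite -sub0r; apply: (subalgB hP); first exact: subalg_0.
        exact: (subalg_mul hP).
      have := posD (Gpos _ (Pext _ _ Px Py))
        (posZ (ltW e0) (pos_starM (b * q y))).
      have gb : g * (b * q y) = q y - e%:C *: (b * q y).
        have : a * (b * q y) = q y by rewrite mulrA ab mul1r.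
        by rewrite {1}/a mulrDl -cstar_scalerAl mul1r => h;
          rewrite -[X in _ = X - _]h addrK.
      rewrite dotE starN !mulNr !mulrN gb opprK mulrBr -cstar_scalerAr.
      set U := star (b * q y) * q y; set V := e%:C *: _.
      set W := star (q y) * _.
      by rewrite (addrAC U) subrr add0r (addrC _ V) !addrA subrr add0r addrC.
  have apos : pos a.
    apply: posD gpos (posZ (ltW e0) _).
    by rewrite -(mulr1 1) -{1}star1; exact: pos_starM.
  (* Completing the square: the perturbed form is [star (x + b * q w) * a * (x + b * q w)] plus the
     form of [G2] at [w], now for arbitrary [x] and [w] in [A]. *)
  have := posD (pos_conj (x + b * q w) apos) (pos2 w); rewrite dot2 dotE.
  have -> : a * (x + b * q w) = g * x + e%:C *: x + q w.
    by rewrite mulrDr mulrA ab mul1r {1}/a mulrDl -cstar_scalerAl mul1r.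
  have -> : star (x + b * q w) * (g * x + e%:C *: x + q w) =
      star x * (g * x) + e%:C *: (star x * x) + star x * q w
      + (star (q w) * x + star (q w) * (b * q w)).
    rewrite starD starM bE mulrDl; congr (_ + _).
      by rewrite !mulrDr -cstar_scalerAr.
    rewrite -[g * x + _](_ : a * x = _); last first.
      by rewrite /a mulrDl -cstar_scalerAl mul1r.
    by rewrite mulrDr -!mulrA (mulrA b a) ba mul1r.
  set X := star x * (g * x); set Y := star x * q w; set Z := star (q w) * x.
  set W := star (q w) * (b * _); set V := e%:C *: _; set S := dot w _.
  have -> // : X + V + Y + (Z + W) + (S - W) = X + Y + Z + S + V.
  by rewrite (addrC S) addrA !(addrA _ Z) addrK (addrAC X) !(addrAC _ V).
rewrite vE; set w := fun j => _; set x := v ord0; apply: pos_closed.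
  by rewrite star_dot dot_mxapp.
move=> e e0; have n0 := nrm_ge0 (star x * x).
have n1 : 0 < nrm (star x * x) + 1 by lra.
have e1 : 0 < e / (nrm (star x * x) + 1) by rewrite divr_gt0.
(* The scaling of [e] keeps the perturbation term below [e] in norm; the added 1 avoids dividing by
   zero. *)
exists (dot (ext x w) (mxapp G (ext x w)) +
  (e / (nrm (star x * x) + 1))%:C *: (star x * x)); first exact: key.
rewrite opprD addrA subrr add0r nrmN nrmZ_ge0 ?(ltW e1) //.
by rewrite mulrAC ler_pdivrMr // ler_pM2l // lerDl.
Qed.

(* Cauchy-Schwarz for the form [G], from its positivity at [s - r (G s)]. *)
Lemma nrm_mxapp_le n (G : 'I_n -> 'I_n -> A) (v : 'I_n -> A) r i :
  (forall i j, star (G i j) = G j i) ->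
  (forall v, pos (dot v (mxapp G v))) -> 0 <= r ->
  2 * r * nrm (mxapp G v i) ^+ 2 <= nrm (dot v (mxapp G v)) +
    r ^+ 2 * nrm (dot (mxapp G v) (mxapp G (mxapp G v))).
Proof.
move=> GE Gpos r0; set w := mxapp G v.
have wE : mxapp G (fun j => v j - r%:C *: w j) =
    fun j => w j - r%:C *: mxapp G w j.
  apply/funext => j; rewrite /w /mxapp scaler_sumr -sumrB.
  apply: eq_bigr => l _.
  by rewrite mulrBr -cstar_scalerAr.
have dE : dot (fun j => v j - r%:C *: w j)
      (mxapp G (fun j => v j - r%:C *: w j))
    + (2 * r)%:C *: dot w w = dot v w + (r ^+ 2)%:C *: dot w (mxapp G w).
  (* The two cross terms of the expansion are [dot v (mxapp G w)] and [dot w w], equal because [G]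
     is hermitian; averaging them lets the terms cancel index by index. *)
  have -> : dot w w = (2^-1)%:C *: (dot v (mxapp G w) + dot w w).
    by rewrite dot_mxapp // half_double.
  rewrite scalerAr (_ : 2 * r * 2^-1 = r); last by field.
  rewrite wE /dot -big_split !scaler_sumr -!big_split /=.
  apply: eq_bigr => j _; set x := v j; set y := w j; set z := mxapp G w j.
  rewrite starB starZr mulrBl !mulrBr -!cstar_scalerAl -!cstar_scalerAr.
  rewrite scalerAr -expr2 scalerDr opprB.
  set U := r%:C *: (star x * z); set V := r%:C *: (star y * y).
  by rewrite addrACA !subrK.
(* The summand of index [i] is separated from positive remaining terms, so that [pos_mono] bounds it
   by the norm of the whole sum. *)
have ipos : pos ((2 * r)%:C *: (star (w i) * w i)).
  by apply: posZ; [rewrite mulr_ge0|exact: pos_starM].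
have wpos : pos (dot (fun j => v j - r%:C *: w j)
    (mxapp G (fun j => v j - r%:C *: w j)) +
    (2 * r)%:C *: \sum_(j | j != i) star (w j) * w j).
  apply: posD => //; apply: posZ; first by rewrite mulr_ge0.
  by apply: (big_ind pos) => //;
    [exact: pos0|exact: posD|move=> j _; exact: pos_starM].
have := pos_mono ipos wpos.
have dw : dot w w = star (w i) * w i + \sum_(j | j != i) star (w j) * w j.
  by rewrite /dot (bigD1 i).
rewrite addrCA -scalerDr -dw dE.
rewrite nrmZ_ge0 ?mulr_ge0 // nrm_starM => h; apply: (le_trans h).
by apply: le_trans (nrmD _ _) _; rewrite nrmZ_ge0 ?sqr_ge0.
Qed.

End CompletelyPositive.

(** * The corner identity in a *-ring with an expectation *)

Section Corner.
Local Open Scope ring_scope.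
Context {B : starRingType} (F : B -> B).
Hypothesis FD : {morph F : x y / x + y}.
Hypothesis F_star : forall x, F (star x) = star (F x).
Hypothesis F_mull : forall x y, F (F x * y) = F x * F y.
Hypothesis F_mulr : forall x y, F (x * F y) = F x * F y.
Context (n : nat) (u v : 'I_n -> B).
Hypothesis basis_l : forall x, x = \sum_i u i * F (v i * x).
Hypothesis basis_r : forall x, x = \sum_i F (x * u i) * v i.
Context (c e : B).
Hypothesis cE : c = \sum_i u i * v i.
Hypothesis cC : forall x, c * x = x * c.
Hypothesis c_star : star c = c.
Hypothesis Fc : F c = c.
Hypothesis ee : e * e = e.
Hypothesis e_star : star e = e.
Hypothesis Fe : c * F e = 1.

(* The defect of [e x = c e F (e x)]: an idempotent, self-adjoint for the inner
   product [F (x^* y)], right-linear over the range of [F], with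
   [\sum_i T (u_i) v_i = 0]. *)
Let T x : B := e * x - c * e * F (e * x).

Let F0 : F 0 = 0.
Proof. by apply: (addrI (F 0)); rewrite -FD !addr0. Qed.

Let FN x : F (- x) = - F x.
Proof. by apply: (addrI (F x)); rewrite -FD !subrr F0. Qed.

Let FB x y : F (x - y) = F x - F y.
Proof. by rewrite FD FN. Qed.

Let F_sum m (H : 'I_m -> B) : F (\sum_i H i) = \sum_i F (H i).
Proof. exact: (big_morph F FD F0). Qed.

Let star_sum' m (H : 'I_m -> B) : star (\sum_i H i) = \sum_i star (H i).
Proof. exact: (big_morph star (@starD B) (@star0 B)). Qed.

Let F_cmul x : F (c * x) = c * F x.
Proof. by rewrite -{1}Fc F_mull Fc. Qed.

Let T_mulr x y : T (x * F y) = T x * F y.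
Proof. by rewrite /T mulrA F_mulr mulrBl !mulrA. Qed.

Let T_sum m (H : 'I_m -> B) : T (\sum_i H i) = \sum_i T (H i).
Proof. by rewrite /T !mulr_sumr F_sum mulr_sumr -sumrB. Qed.

Let F_T x : F (T x) = 0.
Proof.
by rewrite /T FB -mulrA F_cmul F_mulr mulrA Fe mul1r subrr.
Qed.

Let e_T x : e * T x = T x.
Proof.
by rewrite /T mulrBr mulrA ee !mulrA -cC -(mulrA c e e) ee.
Qed.

Let T_T x : T (T x) = T x.
Proof. by rewrite {1}/T e_T F_T mulr0 subr0. Qed.

(** Both sides subtract from [F (star x * e * y)] the same term [c * F (star x * e) * F (e * y)],
    because [c] is central, self-adjoint and fixed by [F]. *)
Let F_T_adj x y : F (star x * T y) = F (star (T x) * y).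
Proof.
rewrite /T mulrBr starB mulrBl !FB; congr (_ - _).
  by rewrite starM e_star mulrA.
have -> : star x * (c * e * F (e * y)) = c * (star x * e * F (e * y)).
  by rewrite -(mulrA c) mulrA -cC !mulrA.
rewrite F_cmul F_mulr.
have -> : star (c * e * F (e * x)) * y = F (star x * e) * (c * (e * y)).
  rewrite !starM c_star e_star -F_star starM e_star -!mulrA.
  by rewrite (mulrA e) -cC !mulrA.
by rewrite F_mull F_cmul !mulrA cC.
Qed.

(** The adjoint of the expansion [basis_r]: the pairs [(star (v i), star (u i))] form a quasi-basis
    too. *)
Let basis_star x : x = \sum_i star (v i) * F (star (u i) * x).
Proof.
rewrite -{1}(starK x) (basis_r (star x)) star_sum'.
by apply: eq_bigr => i _; rewrite starM -F_star starM starK.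
Qed.

Let T_u k : T (u k) = \sum_i T (star (v i)) * F (star (u i) * u k).
Proof.
by rewrite {1}(basis_star (u k)) T_sum; apply: eq_bigr => i _; exact: T_mulr.
Qed.

(** The sum is [e * c - c * e * e]: the first term comes from the definition of the index, the
    second from the expansion of [e] in the quasi-basis. *)
Let sum_T : \sum_i T (u i) * v i = 0.
Proof.
rewrite /T; under eq_bigr do rewrite mulrBl -!mulrA.
rewrite sumrB -mulr_sumr -cE -!mulr_sumr -basis_r ee.
by rewrite cC subrr.
Qed.

(** This is [star (T (star (v i)))], written out so that the statements below do not mention the
    local [T]. *)
Definition corner_coord i : B :=
  star (e * star (v i) - c * e * F (e * star (v i))).

(** Start from [sum_T], write [T (u j)] as [T (T (u j))] and expand the inner one by [basis_star].
    Moving [T] across the inner product lets the sum over [j] collapse by [basis_r] to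
    [star (T (u k))], which [T_u] expands again. *)
Lemma corner_gram :
  \sum_k star (corner_coord k) * \sum_i F (star (u k) * u i) * corner_coord i
  = 0.
Proof.
rewrite -[RHS]sum_T.
under [RHS]eq_bigr => j _ do rewrite -T_T {1}(basis_star (T (u j))) T_sum
  mulr_suml.
rewrite exchange_big /=; apply: eq_bigr => k _.
under [RHS]eq_bigr => j _ do rewrite T_mulr F_T_adj -mulrA.
rewrite -mulr_sumr -basis_r /corner_coord starK -/(T _); congr (_ * _).
rewrite T_u star_sum'; apply: eq_bigr => i _.
by rewrite starM -F_star starM starK.
Qed.

(** The assumed sums are the elements [star (T (u k))], and by right-linearity the values [T (u k)]
    determine [T]. *)
Lemma corner_eq :
  (forall k, \sum_i F (star (u k) * u i) * corner_coord i = 0) ->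
  forall x, e * x = c * e * F (e * x).
Proof.
move=> h x; apply/eqP; rewrite -subr_eq0 -/(T x).
rewrite (basis_l x) T_sum big1 // => k _; rewrite T_mulr.
suff -> : T (u k) = 0 by rewrite mul0r.
suff st : star (T (u k)) = 0 by rewrite -[LHS]starK st star0.
rewrite T_u star_sum' -[RHS](h k).
by apply: eq_bigr => i _; rewrite starM -F_star starM starK.
Qed.

End Corner.

(** * The sequence algebra *)

Section SequenceAlgebra.
Local Open Scope ring_scope.
Local Open Scope complex_scope.
Context {R : realType} {A : cstarAlgType R}.
Implicit Types (a b x y : A) (w z : seq_alg A).

Lemma to_seq_alg0 : to_seq_alg (0 : linf A) = 0.
Proof. by apply: (addrI (to_seq_alg 0)); rewrite -to_seq_algD !addr0. Qed.

Lemma to_seq_algM (s t : linf A) :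
  to_seq_alg (s * t) = to_seq_alg s * to_seq_alg t.
Proof. by rewrite [RHS]seq_alg_mulE. Qed.

Lemma to_seq_alg_star (s : linf A) : to_seq_alg (star s) = star (to_seq_alg s).
Proof. by rewrite [RHS]seq_alg_starE. Qed.

Lemma to_seq_alg_sum n (s : 'I_n -> linf A) :
  to_seq_alg (\sum_i s i) = \sum_i to_seq_alg (s i).
Proof. exact: (big_morph _ (@to_seq_algD _ A) to_seq_alg0). Qed.

Lemma linf_sumE n (s : 'I_n -> linf A) k : (\sum_i s i) k = \sum_i s i k.
Proof. exact: (big_morph (fun t : linf A => t k)). Qed.

Lemma linf_nrm_bound (s : linf A) :
  exists2 M : R, 0 <= M & forall k, nrm (s k) <= M.
Proof.
have [M M0 sM] := linf_bound s.
have Mi : M = (complex.Re M)%:C by rewrite RRe_real // gtr0_real.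
exists (complex.Re M); first by rewrite -ler0c -Mi ltW.
by move=> k; rewrite -lecR -nrmE -Mi.
Qed.

Lemma to_seq_alg_eq0 (s : linf A) : to_seq_alg s = 0 <-> tends s 0.
Proof.
rewrite -to_seq_alg0 -cvg_tends.
split=> [/to_seq_alg_eqP|s0]; first by rewrite subr0 => /c0P.
by apply/to_seq_alg_eqP; rewrite subr0; apply/c0P.
Qed.

Lemma seq_alg_constM a b :
  seq_alg_const a * seq_alg_const b = seq_alg_const (a * b).
Proof. by rewrite -to_seq_algM; congr to_seq_alg; exact/val_inj. Qed.

Lemma seq_alg_const_sum n (a : 'I_n -> A) :
  seq_alg_const (\sum_i a i) = \sum_i seq_alg_const (a i).
Proof.
rewrite -to_seq_alg_sum; congr to_seq_alg; apply/val_inj/funext => k /=.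
by rewrite linf_sumE.
Qed.

Lemma seq_alg_const_star a : star (seq_alg_const a) = seq_alg_const (star a).
Proof. by rewrite -to_seq_alg_star; congr to_seq_alg; exact/val_inj. Qed.

Lemma seq_alg_const1 : seq_alg_const 1 = 1 :> seq_alg A.
Proof. by rewrite -[RHS]/(to_seq_alg 1); congr to_seq_alg; exact/val_inj. Qed.

(** Passes to representing sequences and applies [nrm_mxapp_le] to each term: the form tends to zero
    along the sequence, while the quadratic error stays bounded and is controlled by a small fixed
    parameter. *)
Lemma seq_alg_gram_eq0 n (G : 'I_n -> 'I_n -> A) (t : 'I_n -> seq_alg A) :
  (forall i j, star (G i j) = G j i) ->
  (forall v, pos (dot v (mxapp G v))) ->
  \sum_k star (t k) * \sum_i seq_alg_const (G k i) * t i = 0 ->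
  forall k, \sum_i seq_alg_const (G k i) * t i = 0.
Proof.
move=> GE Gpos.
pose s k : linf A := seq_alg_repr (t k).
have tE : t = fun k => to_seq_alg (s k).
  by apply/funext => k; rewrite seq_alg_reprK.
pose app (v : 'I_n -> linf A) k : linf A := \sum_i linf_const (G k i) * v i.
have appE v k m : app v k m = mxapp G (fun i => v i m) k.
  by rewrite /app linf_sumE; apply: eq_bigr.
have to_app v k : to_seq_alg (app v k) =
    \sum_i seq_alg_const (G k i) * to_seq_alg (v i).
  by rewrite to_seq_alg_sum; apply: eq_bigr => i _; rewrite to_seq_algM.
pose Q v : linf A := \sum_k star (v k) * app v k.
have QE v m : Q v m = dot (fun i => v i m) (mxapp G (fun i => v i m)).
  by rewrite /Q linf_sumE; apply: eq_bigr => i _; rewrite -appE.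
rewrite tE => t0 k; rewrite -to_app; apply/to_seq_alg_eq0 => e e0.
have Q0 : tends (Q s) 0.
  apply/to_seq_alg_eq0; rewrite -[RHS]t0 to_seq_alg_sum; apply: eq_bigr => i _.
  by rewrite to_seq_algM to_seq_alg_star to_app.
have [C C0 QC] := linf_nrm_bound (Q (app s)).
(* With this parameter the error [d ^+ 2 * C] is at most [d * e ^+ 2]. The form is eventually below
   [d * e ^+ 2] too, and dividing by [2 * d] leaves [e ^+ 2]. *)
pose d := e ^+ 2 / (C + 1).
have d0 : 0 < d by rewrite divr_gt0 ?exprn_gt0 //; lra.
have dC : d * C <= e ^+ 2.
  rewrite /d mulrAC ler_pdivrMr; last by lra.
  by apply: ler_wpM2l; [exact: sqr_ge0|lra].
have [|N QN] := Q0 (d * e ^+ 2); first by rewrite mulr_gt0 ?exprn_gt0.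
exists N => m /QN; rewrite !subr0 => Qm.
have := nrm_mxapp_le (fun i => s i m) k GE Gpos (ltW d0).
rewrite -QE -appE.
have -> : mxapp G (fun i => s i m) = fun i => app s i m.
  by apply/funext => i; rewrite appE.
rewrite -QE => h.
have := QC m; have := nrm_ge0 (app s k m) => x0 QCm.
have : d ^+ 2 * nrm (Q (app s) m) <= d * e ^+ 2.
  rewrite expr2 -mulrA ler_pM2l //; apply: le_trans dC.
  by rewrite ler_pM2l.
move=> h2; rewrite -(ltr_pXn2r (n := 2)) ?nnegrE ?(ltW e0) //.
rewrite -(ltr_pM2l d0); lra.
Qed.

(** * Conditional expectations and their extension to the sequence algebra *)

Section CondExp.
Context (P : set A) (hP : unital_cstar_subalgebra P) (E : condExp P).

Lemma condExpD x y : E (x + y) = E x + E y.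
Proof. by rewrite -{1}[x]scale1r condExp_linear scale1r. Qed.

Lemma condExp0 : E 0 = 0.
Proof. by apply: (addrI (E 0)); rewrite -condExpD !addr0. Qed.

Lemma condExpZ (c : R[i]) x : E (c *: x) = c *: E x.
Proof. by rewrite -[c *: x]addr0 condExp_linear condExp0 addr0. Qed.

Lemma condExp_sum n (x : 'I_n -> A) : E (\sum_i x i) = \sum_i E (x i).
Proof. exact: (big_morph E condExpD condExp0). Qed.

(** Positivity at [1 + y] forces the defect [D y = E (star y) - star (E y)] to be self-adjoint.
    Since [D] is conjugate-linear in ['i], self-adjointness of [D ('i *: x)] as well gives
    [D x = 0]. *)
Lemma condExp_star x : E (star x) = star (E x).
Proof.
pose D y := E (star y) - star (E y).
have Esa y : star (E (star y * y)) = E (star y * y).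
  by have [z _ ->] := condExp_pos E y; rewrite starM starK.
have E1 : E 1 = 1 by rewrite condExp_id //; exact: subalg_one.
have D_sa y : star (D y) = D y.
  have := Esa (1 + y); rewrite starD star1 mulrDl !mulrDr !mul1r mulr1.
  rewrite !condExpD !starD Esa E1 star1 => h; rewrite /D starN starK.
  have {h} h : star (E (star y)) + star (E y) = E y + E (star y).
    apply: (addrI 1); apply: (addIr (E (star y * y))).
    rewrite -!addrA in h; rewrite (addrC (star (E (star y)))) -!addrA h.
    by rewrite ?addrA.
  by apply/eqP; rewrite subr_eq addrAC eq_sym subr_eq h addrC.
have DiE : D ('i *: x) = - 'i *: D x.
  rewrite /D starZ !condExpZ starZ -scalerBr; congr (_ *: _).
  by apply/eqP; rewrite eq_complex /= oppr0 !eqxx.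
have := D_sa ('i *: x); rewrite DiE starZ D_sa.
have -> : (- 'i)^*%R = 'i :> R[i].
  by apply/eqP; rewrite eq_complex /= oppr0 opprK !eqxx.
rewrite scaleNr => /eqP; rewrite -subr_eq0 opprK => /eqP iD.
apply/eqP; rewrite -subr_eq0 -/(D x); apply/eqP.
rewrite -[D x]scale1r (_ : 1 = - ('i * 'i)); last by rewrite -expr2 sqr_i opprK.
by rewrite scaleNr -scalerA -[X in 'i *: X]half_double iD !scaler0 oppr0.
Qed.

Lemma condExp_seqD w z :
  condExp_seq E (w + z) = condExp_seq E w + condExp_seq E z.
Proof.
move: w z; elim/(@seq_alg_ind R A)=> s; elim/(@seq_alg_ind R A)=> t.
rewrite -to_seq_algD !condExp_seqE -to_seq_algD; congr to_seq_alg.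
by apply/val_inj/funext => n; exact: condExpD.
Qed.

Lemma condExp_seq_star w : condExp_seq E (star w) = star (condExp_seq E w).
Proof.
move: w; elim/(@seq_alg_ind R A)=> s.
rewrite -to_seq_alg_star !condExp_seqE -to_seq_alg_star; congr to_seq_alg.
by apply/val_inj/funext => n; exact: condExp_star.
Qed.

Lemma condExp_seq_mull w z :
  condExp_seq E (condExp_seq E w * z) = condExp_seq E w * condExp_seq E z.
Proof.
move: w z; elim/(@seq_alg_ind R A)=> s; elim/(@seq_alg_ind R A)=> t.
rewrite (condExp_seqE E s) (condExp_seqE E t) -!to_seq_algM condExp_seqE.
congr to_seq_alg.
by apply/val_inj/funext => n; apply: condExp_mull; exact: condExp_in.
Qed.

Lemma condExp_seq_mulr w z :
  condExp_seq E (w * condExp_seq E z) = condExp_seq E w * condExp_seq E z.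
Proof.
move: w z; elim/(@seq_alg_ind R A)=> s; elim/(@seq_alg_ind R A)=> t.
rewrite (condExp_seqE E s) (condExp_seqE E t) -!to_seq_algM condExp_seqE.
congr to_seq_alg.
by apply/val_inj/funext => n; apply: condExp_mulr; exact: condExp_in.
Qed.

Lemma condExp_seq_const a :
  condExp_seq E (seq_alg_const a) = seq_alg_const (E a).
Proof. by rewrite condExp_seqE; congr to_seq_alg; exact/val_inj. Qed.

(** * Quasi-bases, the Watatani index and the Rokhlin projection *)

Section QuasiBasis.
Context n (u v : 'I_n -> A) (uv : quasi_basis E u v).
Let c := watatani_index E.

(** Together with the independence of the index from the quasi-basis, this makes the index
    self-adjoint. *)
Lemma quasi_basis_star :
  quasi_basis E (fun i => star (v i)) (fun i => star (u i)).
Proof.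
move=> a; split.
  rewrite -{1}(starK a) {1}(uv (star a)).2 star_sum; apply: eq_bigr => i _.
  by rewrite starM -condExp_star starM starK.
rewrite -{1}(starK a) {1}(uv (star a)).1 star_sum; apply: eq_bigr => i _.
by rewrite starM -condExp_star starM starK.
Qed.

Lemma watatani_index_star : star c = c.
Proof.
rewrite /c {1}(watatani_indexE uv) (watatani_indexE quasi_basis_star) star_sum.
by apply: eq_bigr => i _; rewrite starM.
Qed.

(** Expand each [v i * a] on the right, exchange the two sums, and recognize the left expansion of
    [a * u j]. *)
Lemma watatani_index_central a : c * a = a * c.
Proof.
rewrite /c (watatani_indexE uv) mulr_sumr mulr_suml.
under eq_bigr => i _ do rewrite -mulrA {1}(uv (v i * a)).2 mulr_sumr.
rewrite exchange_big /=; apply: eq_bigr => j _.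
rewrite mulrA (_ : a * u j = \sum_i u i * E (v i * (a * u j))); last first.
  exact: (uv _).1.
by rewrite mulr_suml; apply: eq_bigr => i _; rewrite !mulrA.
Qed.

(** On tuples from [P] the form is [E (star z * z)] with [z = \sum_i u i * p i], hence positive;
    [completely_positive] extends this to tuples from [A]. *)
Lemma quasi_basis_gram_pos (x : 'I_n -> A) :
  pos (dot x (mxapp (fun i j => E (star (u i) * u j)) x)).
Proof.
apply: (completely_positive hP) => [i j|i j|p Pp].
- exact: condExp_in.
- by rewrite -condExp_star starM starK.
- have -> : dot p (mxapp (fun i j => E (star (u i) * u j)) p) =
      E (star (\sum_i u i * p i) * \sum_i u i * p i).
    rewrite star_sum mulr_suml condExp_sum.
    apply: eq_bigr => i _; rewrite starM -mulrA condExp_mull; last first.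
      exact: subalg_star.
    congr (_ * _); rewrite mulr_sumr condExp_sum.
    by apply: eq_bigr => j _; rewrite mulrA (condExp_mulr E _ (Pp j)).
  have [y _ ->] := condExp_pos E (\sum_i u i * p i).
  exact: pos_starM.
Qed.

Lemma seq_quasi_basis_l w : w =
  \sum_i seq_alg_const (u i) * condExp_seq E (seq_alg_const (v i) * w).
Proof.
move: w; elim/(@seq_alg_ind R A)=> s.
under eq_bigr => i _.
  rewrite -(to_seq_algM (linf_const (v i)) s) condExp_seqE.
  rewrite -(to_seq_algM (linf_const (u i))); over.
rewrite -to_seq_alg_sum; congr to_seq_alg; apply/val_inj/funext => m /=.
by rewrite linf_sumE; exact: (uv _).1.
Qed.

Lemma seq_quasi_basis_r w : w =
  \sum_i condExp_seq E (w * seq_alg_const (u i)) * seq_alg_const (v i).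
Proof.
move: w; elim/(@seq_alg_ind R A)=> s.
under eq_bigr => i _.
  rewrite -(to_seq_algM s (linf_const (u i))) condExp_seqE.
  rewrite -(to_seq_algM _ (linf_const (v i))); over.
rewrite -to_seq_alg_sum; congr to_seq_alg; apply/val_inj/funext => m /=.
by rewrite linf_sumE; exact: (uv _).2.
Qed.

Lemma watatani_index_seq_central w :
  seq_alg_const c * w = w * seq_alg_const c.
Proof.
move: w; elim/(@seq_alg_ind R A)=> s; rewrite -!to_seq_algM; congr to_seq_alg.
by apply/val_inj/funext => m; exact: watatani_index_central.
Qed.

(** The abstract corner identity for the extended expectation. [seq_alg_gram_eq0] bridges
    [corner_gram] and the hypothesis of [corner_eq], and [P c] makes the constant class of [c] a
    fixed point. *)
Lemma rokhlin_corner (e : seq_alg A) (g : A) :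
  projection e -> P c -> c * g = 1 -> condExp_seq E e = seq_alg_const g ->
  forall w, e * w = seq_alg_const c * e * condExp_seq E (e * w).
Proof.
move=> [ee e_star] Pc cg Ee.
pose U i := seq_alg_const (u i); pose V i := seq_alg_const (v i).
have GE i j : condExp_seq E (star (U i) * U j) =
    seq_alg_const (E (star (u i) * u j)).
  by rewrite seq_alg_const_star seq_alg_constM condExp_seq_const.
have cE : seq_alg_const c = \sum_i U i * V i.
  rewrite /c (watatani_indexE uv) seq_alg_const_sum.
  by apply: eq_bigr => i _; rewrite seq_alg_constM.
have c_star : star (seq_alg_const c) = seq_alg_const c.
  by rewrite seq_alg_const_star watatani_index_star.
have Ec : condExp_seq E (seq_alg_const c) = seq_alg_const c.
  by rewrite condExp_seq_const condExp_id.
have Fe : seq_alg_const c * condExp_seq E e = 1.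
  by rewrite Ee seq_alg_constM cg seq_alg_const1.
have gram := corner_gram condExp_seqD condExp_seq_star condExp_seq_mull
  condExp_seq_mulr seq_quasi_basis_r cE watatani_index_seq_central c_star Ec
  ee e_star Fe.
apply: (corner_eq condExp_seqD condExp_seq_star condExp_seq_mulr
  seq_quasi_basis_l seq_quasi_basis_r) => k.
under eq_bigr do rewrite GE.
apply: (@seq_alg_gram_eq0 n (fun i j => E (star (u i) * u j))).
- by move=> i j; rewrite -condExp_star starM starK.
- exact: quasi_basis_gram_pos.
- rewrite -[RHS]gram; apply: eq_bigr => i _; congr (_ * _).
  by apply: eq_bigr => j _; rewrite GE.
Qed.

End QuasiBasis.
End CondExp.
End SequenceAlgebra.

(** * Lifting projections *)

Section Lifting.
Local Open Scope ring_scope.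
Local Open Scope complex_scope.
Context {R : realType} {A : cstarAlgType R}.
Implicit Types (x y z h f : A) (r e : R).

(* [f = (1 + y) / 2], with [y = x (x^2)^(-1/2)] the sign of [x = 2 h - 1]. *)
Lemma near_projection (P : set A) h : unital_cstar_subalgebra P -> P h ->
  star h = h -> nrm (h * h - h) <= 8^-1 ->
  exists f, [/\ P f, projection f & nrm (f - h) <= 2 * nrm (h * h - h)].
Proof.
move=> hP Ph hE h8.
have P1 := subalg_one hP.
pose x := h + h - 1.
have Px : P x by apply: subalgB => //; exact: subalg_add.
have xE : star x = x by rewrite starB starD hE star1.
(* This is [1 - x * x], of norm at most one half by the assumption on [h]. *)
pose k := 4%:C *: (h - h * h).
have nk : nrm k = 4 * nrm (h * h - h) by rewrite nrmZ_ge0 // nrmBC.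
have kE : star k = k by rewrite starZr starB starM hE.
have Pk : P k.
  by apply: subalg_scale => //; apply: (subalgB hP) => //; exact: subalg_mul.
have xx : x * x = 1 - k.
  have -> : k = (h + h + (h + h)) - (h * h + h * h + (h * h + h * h)).
    have dbl y y' : (y - y') + (y - y') = (y + y) - (y' + y').
      by rewrite addrACA opprD.
    rewrite /k (_ : 4 = 1 + 1 + (1 + 1)); last by lra.
    by rewrite !rmorphD !scalerDl !scale1r !dbl.
  rewrite /x mulrBl mulrBr mulr1 mul1r mulrDl !mulrDr !opprB.
  by rewrite [LHS]addrC addrACA -opprD [RHS]addrA.
have k1 : nrm k <= 1 by rewrite nk; lra.
have [z [zE zk zz zC zP]] := sqrt_1B kE k1.
have z1 : nrm z < 1 by apply: le_lt_trans zk _; rewrite nk; lra.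
(* As [1 - z] is a square root of [x * x], its inverse [s] is the inverse absolute value of [x]. *)
have [s [zs sz sP]] := neumann_inverse z1.
have Pz := zP _ hP Pk; have Ps := sP _ hP Pz.
have xz : x * z = z * x.
  apply: zC; have -> : k = 1 - x * x by rewrite xx subKr.
  by rewrite [LHS]mulrBr mulr1 [RHS]mulrBl mul1r mulrA.
have xs : x * s = s * x.
  rewrite -[LHS]mul1r -sz -mulrA (mulrA _ x) (_ : (1 - z) * x = x * (1 - z)).
    by rewrite -(mulrA x) zs mulr1.
  by rewrite [LHS]mulrBl [RHS]mulrBr mul1r mulr1 xz.
have sE : star s = s.
  have zE' : star (1 - z) = 1 - z by rewrite starB star1 zE.
  by rewrite -[LHS]mulr1 -zs mulrA -{1}zE' -starM zs star1 mul1r.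
pose y := x * s.
have yE : star y = y by rewrite /y starM xE sE xs.
have yy : y * y = 1.
  rewrite /y {1}xs -mulrA (mulrA x x) xx -zz -mulrA zs mulr1.
  by rewrite sz.
(* Since [x = y * (1 - z)], the error [f - h] is half of [y * z], of norm at most half of [nrm k],
   which is the claimed bound. *)
have yx : y - x = y * z.
  have yz : y * (1 - z) = x by rewrite /y -mulrA sz mulr1.
  by rewrite -[in LHS]yz mulrBr mulr1 subKr.
have y1 : nrm y <= 1.
  have := nrm_sqr yE; rewrite yy.
  by have := nrm1_le1 (A := A); have := nrm_ge0 y; nra.
pose f := (2^-1)%:C *: (1 + y); exists f; split.
- by apply: subalg_scale => //; apply: subalg_add => //; exact: subalg_mul.
- split; last by rewrite starZr starD star1 yE.
  rewrite /f scalerMMr mulrDl !mulrDr !mul1r mulr1 yy (addrC y 1) scalerDr.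
  by rewrite -scalerDr -scalerAr half_double.
- have -> : f - h = (2^-1)%:C *: (y * z).
    rewrite -yx /f /x opprB addrA (addrC y) -[h in LHS]half_double -scalerBr.
    by rewrite -addrA (addrC y) opprD !addrA.
  rewrite nrmZ_ge0 ?invr_ge0 ?ler0n //.
  have h1 := nrmM y z; have h2 := nrm_ge0 y; have h3 := nrm_ge0 z.
  have h4 : nrm y * nrm z <= nrm z by rewrite ler_piMl.
  rewrite nk in zk; lra.
Qed.

(** The real parts of the [s n] differ from [s n] by a null sequence and are asymptotically
    idempotent, so [near_projection] applies to them from some index on. *)
Lemma lift_projection (P : set A) (s : linf A) e :
  unital_cstar_subalgebra P -> (forall n, P (s n)) ->
  projection (to_seq_alg s) -> 0 < e ->
  exists N, forall n, (N <= n)%N ->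
    exists f, [/\ P f, projection f & nrm (f - s n) < e].
Proof.
move=> hP Ps [ss sE] e0.
(* The real part of [s], written as [s] plus a correction so that its class is visibly that of
   [s]. *)
pose H : linf A := s + linf_const ((2^-1)%:C *: (1 : A)) * (star s - s).
have Hn n : H n = (2^-1)%:C *: (s n + star (s n)).
  rewrite -[LHS]/(s n + (2^-1)%:C *: (1 : A) * (star (s n) - s n)).
  rewrite -cstar_scalerAl mul1r -{1}[s n]half_double -scalerDr.
  by rewrite addrA addrAC addrK.
have to_star : to_seq_alg (star s - s) = 0.
  apply/to_seq_alg_eq0; apply/cvg_tends/c0P; apply/to_seq_alg_eqP.
  by rewrite to_seq_alg_star.
have toH : to_seq_alg H = to_seq_alg s.
  by rewrite to_seq_algD to_seq_algM to_star mulr0 addr0.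
have H0 : tends (fun n => H n - s n) 0.
  by apply/cvg_tends; apply/(c0P (H - s)); apply/to_seq_alg_eqP.
have HH0 : tends (fun n => H n * H n - H n) 0.
  apply/cvg_tends; apply/(c0P (H * H - H)); apply/to_seq_alg_eqP.
  by rewrite to_seq_algM toH.
have e4 : 0 < e / 4 by lra.
(* The bound by [8^-1] is required by [near_projection]; the bounds by [e / 4] yield a total error
   below [e / 2 + e / 4]. *)
have e8 : 0 < Num.min (8^-1) (e / 4) by rewrite lt_min e4 andbT invr_gt0.
have [N HN] := H0 _ e4; have [M HM] := HH0 _ e8.
exists (maxn N M) => n; rewrite geq_max => /andP[/HN + /HM]; rewrite !subr0.
rewrite lt_min => h1 /andP[h2 h3].
have HE : star (H n) = H n by rewrite Hn starZr starD starK addrC.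
have PH : P (H n).
  by rewrite Hn; apply: subalg_scale => //; apply: subalg_add => //;
    exact: subalg_star.
have [f [Pf pf fH]] := near_projection hP PH HE (ltW h2).
exists f; split => //.
have := nrmD (f - H n) (H n - s n); rewrite addrA subrK; lra.
Qed.

End Lifting.

(** * Transfer of approximation by projections from the algebra to the subalgebra *)

Section LinearSpan.
Local Open Scope classical_set_scope.
Local Open Scope ring_scope.
Local Open Scope complex_scope.
Context {R : realType} {A : cstarAlgType R}.

Lemma common_bound n (Q : 'I_n -> nat -> Prop) :
  (forall i, exists N, forall m, (N <= m)%N -> Q i m) ->
  exists N, forall m, (N <= m)%N -> forall i, Q i m.
Proof.
move=> /fin_all_exists[N NQ]; exists (\max_i N i) => m Nm i.
by apply: NQ; apply: leq_trans Nm; exact: leq_bigmax.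
Qed.

Lemma nrm_sum n (F : 'I_n -> A) : nrm (\sum_i F i) <= \sum_i nrm (F i).
Proof.
elim: n F => [|n IH] F; first by rewrite !big_ord0 nrm0.
rewrite !big_ord_recl; apply: le_trans (nrmD _ _) _.
by rewrite lerD2l.
Qed.

Lemma rokhlin_LP (P : set A) (E : condExp P) :
  unital_cstar_subalgebra P -> finite_index E -> has_LP [set: A] ->
  rokhlin_property E -> has_LP P.
Proof.
move=> hP [n [u [v uv]]] hA [e [pe e_central [g [cg gc] Ee] _]].
set c := watatani_index E in cg gc.
pose s := seq_alg_repr e.
have sE : to_seq_alg s = e by exact: seq_alg_reprK.
(* The Rokhlin condition, read on representatives, exhibits the inverse index as a limit of elements
   of the closed set [P]. *)
have Eg : tends (fun n => E (s n)) g.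
  apply/cvg_tends; have : condExp_linf E s - linf_const g \in @c0 R A.
    by apply/to_seq_alg_eqP; rewrite -condExp_seqE sE.
  move/c0P => /cvg_tends h; apply/cvg_tends => r /h[N hN].
  by exists N => m /hN; rewrite subr0.
have Pg : P g.
  by apply: (closed_tends (Defs.subalg_closed hP) _ Eg) => m; exact: condExp_in.
have Pc : P c.
  (* Since [g] lies in [P] and inverts [c], [E c = E c * g * c = E (c * g) * c = c]. *)
  have Ec : E c = c.
    rewrite -[LHS]mulr1 -gc mulrA -(condExp_mulr E _ Pg) cg.
    by rewrite (condExp_id E (subalg_one hP)) mul1r.
  by rewrite -Ec; exact: condExp_in.
have key := rokhlin_corner hP uv pe Pc cg Ee.
pose C := @seq_alg_const R A.
have cC w : C c * w = w * C c by exact: watatani_index_seq_central.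
have EC w : condExp_seq E (C c * w) = C c * condExp_seq E w.
  have EcE : condExp_seq E (C c) = C c by rewrite condExp_seq_const condExp_id.
  by rewrite -{1}EcE condExp_seq_mull EcE.
(* With [F] for the extended expectation and [p] for its constant class, the corner identity gives
   [F (e p) c F (e p) = F (p c e F (e p)) = F (p e p) = F (e p)], as [e] commutes with [p].
   Self-adjointness uses the same commutation and the centrality of [c]. *)
have beta_proj p : projection p -> projection (C c * condExp_seq E (e * C p)).
  move=> [pp p_star]; have eCp := e_central p; split.
    suff h : condExp_seq E (e * C p) * (C c * condExp_seq E (e * C p)) =
        condExp_seq E (e * C p) by rewrite -mulrA h.
    rewrite -EC -condExp_seq_mulr EC {1}eCp -mulrA (mulrA e) -cC -key eCp.
    by rewrite mulrA seq_alg_constM pp -eCp.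
  rewrite starM -(condExp_seq_star hP E (e * C p)) starM pe.2.
  by rewrite !seq_alg_const_star p_star (watatani_index_star hP uv) -/(C p) -eCp
    -/(C c) cC.
move=> x Px; apply/closureP => d d0.
have [M M0 sM] := linf_nrm_bound s.
(* This constant bounds the maps [beta m] below uniformly in [m], so approximating [x] within
   [d / 3] divided by it costs less than [d / 3] after applying [beta m]. *)
have K0 : 0 < nrm c * M + 1 by have := mulr_ge0 (nrm_ge0 c) M0; lra.
have d3 : 0 < d / 3 by lra.
have /closureP /(_ _ (divr_gt0 d3 K0)) [y [l [a [p [Pp ->]]]] xy] :
  closure (lin_span [set q : A | [set: A] q /\ projection q]) x by exact: hA.
pose beta m z := c * E (s m * z).
have betaB m z z' : beta m (z - z') = beta m z - beta m z'.
  by rewrite /beta mulrBr condExpB mulrBr.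
have beta_sum m : beta m (\sum_i a i *: p i) = \sum_i a i *: beta m (p i).
  rewrite /beta mulr_sumr condExp_sum mulr_sumr; apply: eq_bigr => i _.
  by rewrite -cstar_scalerAr condExpZ -cstar_scalerAr.
have beta_nrm m z : nrm (beta m z) <= nrm c * M * nrm z.
  rewrite /beta; apply: le_trans (nrmM _ _) _.
  rewrite -mulrA ler_wpM2l ?nrm_ge0 //.
  have h : nrm (E (s m * z)) <= nrm (s m * z).
    by rewrite -lecR -!nrmE condExp_contractive.
  apply: (le_trans h); apply: le_trans (nrmM _ _) _.
  by apply: ler_wpM2r (sM m); exact: nrm_ge0.
(* For [x] in [P], [c * E (s m * x) = c * E (s m) * x], which tends to [c * g * x = x]. *)
have beta_x : tends (fun m => beta m x) x.
  have h := tendsM (tends_cst c) (tendsM Eg (tends_cst x)).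
  rewrite mulrA cg mul1r in h; move=> r /h[N hN]; exists N => m /hN.
  by rewrite /beta condExp_mulr.
(* Lifting each projection within [d / 3 / S] makes the weighted errors add up to at most [d / 3];
   the 1 keeps [S] positive. *)
pose S := \sum_i complex.Re `|a i| + 1.
have a0 i : 0 <= complex.Re `|a i| by rewrite normc_def /= sqrtr_ge0.
have S0 : 0 < S.
  have : 0 <= \sum_i complex.Re `|a i| by apply: sumr_ge0 => i _.
  by rewrite /S; lra.
have [N1 h1] := beta_x _ d3.
have lift_p i : exists N, forall m, (N <= m)%N -> exists f,
    [/\ P f, projection f & nrm (f - beta m (p i)) < d / 3 / S].
  pose t : linf A := linf_const c * condExp_linf E (s * linf_const (p i)).
  apply: (@lift_projection R A P t) => //; last exact: divr_gt0.
    by move=> m; apply: (subalg_mul hP) => //; exact: condExp_in.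
  rewrite to_seq_algM -condExp_seqE to_seq_algM sE.
  by apply: beta_proj; case: (Pp i).
have [N2 h2] := common_bound lift_p.
(* A single index serves both the convergence at [x] and the finitely many liftings. *)
pose m := maxn N1 N2.
have {}h1 := h1 m (leq_maxl _ _).
have /fin_all_exists[f fP] := h2 m (leq_maxr _ _).
exists (\sum_i a i *: f i).
  exists l, a, f; split => // i; split; by case: (fP i).
have h3 : nrm (beta m x - beta m (\sum_i a i *: p i)) < d / 3.
  rewrite -betaB; apply: le_lt_trans (beta_nrm _ _) _.
  rewrite ltr_pdivlMr // in xy; have := nrm_ge0 (x - \sum_i a i *: p i); lra.
have h4 : nrm (beta m (\sum_i a i *: p i) - \sum_i a i *: f i) <= d / 3.
  rewrite beta_sum -sumrB; apply: le_trans (nrm_sum _) _.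
  apply: (@le_trans _ _ (\sum_i complex.Re `|a i| * (d / 3 / S))).
    apply: ler_sum => i _; rewrite -scalerBr nrmZ; apply: ler_wpM2l => //.
    by rewrite nrmBC; case: (fP i) => _ _ /ltW.
  rewrite -mulr_suml mulrA ler_pdivrMr // mulrC ler_pM2l // /S; lra.
have := nrmD (x - beta m x) (beta m x - \sum_i a i *: f i).
have := nrmD (beta m x - beta m (\sum_i a i *: p i))
  (beta m (\sum_i a i *: p i) - \sum_i a i *: f i).
rewrite !addrA !subrK nrmBC in h1 *; lra.
Qed.

End LinearSpan.

Local Open Scope classical_set_scope.

Theorem theorem3p1 (R : realType) (A : cstarAlgType R) (P : set A)
    (hP : unital_cstar_subalgebra P) (E : condExp P)
    (hfaithful : faithful E) (hindex : finite_index E)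
    (hA : has_LP [set: A]) (hE : rokhlin_property E) :
  has_LP P.
Proof. exact: (rokhlin_LP hP hindex hA hE). Qed.
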